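(* Let $R$ be a Burch local ring of depth $t$. Let $M,N$ be finitely generated $R$-modules. Assume that there exists an integer $l\ge\max\{3,t+1\}$ such that $\operatorname{Tor}_i^R(M,N)=0$ for all $l+t\le i\le l+2t+1$. Then either $M$ or $N$ has finite projective dimension.
   Context: All rings are commutative and noetherian. An ideal $I$ of a local ring $(S,\mathfrak n)$ is a Burch ideal if $\mathfrak n I\neq\mathfrak n(I:_S\mathfrak n)$. A local ring $(R,\mathfrak m)$ of depth $t$ with completion $\widehat R$ is a Burch ring if there exist a maximal $\widehat R$-regular sequence $\boldsymbol{x}=x_1,\dots,x_t$ in $\widehat R$, a regular local ring $S$ and a Burch ideal $I$ of $S$ with $\widehat R/(\boldsymbol{x})\cong S/I$. *)

(* Defs.v *)
From HB Require Import structures.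
From mathcomp Require Import all_boot all_order all_algebra.
From mathcomp Require Import mathcomp_extra boolp classical_sets functions.
From mathcomp Require Import freeg ring.

Set Implicit Arguments.
Unset Strict Implicit.
Unset Printing Implicit Defensive.

Import GRing.Theory.
Local Open Scope ring_scope.
Local Open Scope classical_set_scope.

(* Ideals are sets [I : set R], possibly improper.  The library's [idealr R]  *)
(* (proper ideals, as boolean predicates) is used where a quotient ring       *)
(* [{ideal_quot I}] is formed; [[set` I]] is the underlying set.              *)

Section Ideals.
Variable R : comNzRingType.
Implicit Types (I J P m : set R) (A : set R).

Definition ideal I : Prop :=
  I 0 /\ forall a x y, I x -> I y -> I (a * x + y).

Definition ideal_span A : set R := smallest ideal A.

Definition ideal_mul I J : set R :=
  ideal_span [set x * y | x in I & y in J].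

Definition ideal_exp I (n : nat) : set R := iter n (ideal_mul I) setT.

Definition ideal_colon I J : set R := [set a | forall b, J b -> I (a * b)].

Definition noetherian : Prop :=
  forall I, ideal I -> exists s : seq R, I = ideal_span [set` s].

Definition prime_ideal P : Prop :=
  [/\ ideal P, ~ P 1 & forall x y, P (x * y) -> P x \/ P y].

Definition maximal_ideal m : Prop :=
  [/\ ideal m, ~ m 1 & forall I, ideal I -> ~ I 1 -> m `<=` I -> I = m].

Definition local_ring m : Prop :=
  [/\ noetherian, maximal_ideal m & forall m', maximal_ideal m' -> m' = m].

Definition prime_chain (d : nat) (p : nat -> set R) : Prop :=
  (forall i, (i <= d)%N -> prime_ideal (p i)) /\
  (forall i, (i < d)%N -> p i `<` p i.+1).

Definition krull_dim (d : nat) : Prop :=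
  (exists p, prime_chain d p) /\ forall p, ~ prime_chain d.+1 p.

Definition regular_local_ring m : Prop :=
  local_ring m /\
  exists2 d, krull_dim d &
    exists x : d.-tuple R, m = ideal_span [set` x].

Definition burch_ideal m I : Prop :=
  ideal I /\ ideal_mul m I <> ideal_mul m (ideal_colon I m).

Definition regular_seq (x : seq R) : Prop :=
  ~ ideal_span [set` x] 1 /\
  forall i, (i < size x)%N -> forall a,
    ideal_span [set` take i x] (x`_i * a) -> ideal_span [set` take i x] a.

Definition maximal_regular_seq (x : seq R) : Prop :=
  regular_seq x /\ forall y, ~ regular_seq (rcons x y).

Definition has_depth m (t : nat) : Prop :=
  (exists x : t.-tuple R, regular_seq x /\ [set` x] `<=` m) /\
  (forall x : seq R, regular_seq x -> [set` x] `<=` m -> (size x <= t)%N).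

Lemma ideal_spanP A : ideal (ideal_span A).
Proof.
split=> [I [[I0 _] _]|a x y xA yA I [idI AI]]; first exact: I0.
by apply: idI.2; [apply: xA|apply: yA].
Qed.

Lemma ideal_expP I n : ideal (ideal_exp I n).
Proof. by case: n => [|n]; [by split|exact: ideal_spanP]. Qed.

End Ideals.

Arguments noetherian : clear implicits.

(* The m-adic completion: Cauchy sequences modulo null sequences.             *)
Section Completion.
Variables (R : comNzRingType) (m : idealr R).
Local Notation m_exp := (ideal_exp [set` m]).

Definition cauchy_pred : {pred nat -> R} := fun u =>
  `[< forall n, exists k, forall i j,
        (k <= i)%N -> (k <= j)%N -> m_exp n (u i - u j) >].

Lemma cauchy_subring : subring_closed cauchy_pred.
Proof.
split=> [|u v /asboolP cu /asboolP cv|u v /asboolP cu /asboolP cv].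
- apply/asboolP => n; exists 0%N => i j _ _.
  by rewrite subrr; have [] := ideal_expP [set` m] n.
- apply/asboolP => n; have [k ku] := cu n; have [k' kv] := cv n.
  exists (maxn k k') => i j; rewrite !geq_max => /andP[ki k'i] /andP[kj k'j].
  have [_ ID] := ideal_expP [set` m] n.
  have -> : (u - v) i - (u - v) j = -1 * (v i - v j) + (u i - u j).
    by rewrite !fctE; ring.
  by apply: ID; [apply: kv|apply: ku].
- apply/asboolP => n; have [k ku] := cu n; have [k' kv] := cv n.
  exists (maxn k k') => i j; rewrite !geq_max => /andP[ki k'i] /andP[kj k'j].
  have [I0 ID] := ideal_expP [set` m] n.
  have -> : (u * v) i - (u * v) j
          = u i * (v i - v j) + (v j * (u i - u j) + 0).
    by rewrite !fctE; ring.
  by apply: (ID); [apply: kv|apply: ID => //; apply: ku].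
Qed.

HB.instance Definition _ :=
  GRing.isSubringClosed.Build (nat -> R) cauchy_pred cauchy_subring.

Record cauchy_seq := CauchySeq { cauchy_val : nat -> R; _ : cauchy_val \in cauchy_pred }.

HB.instance Definition _ := [isSub for cauchy_val].
HB.instance Definition _ := [Choice of cauchy_seq by <:].
HB.instance Definition _ := [SubChoice_isSubComNzRing of cauchy_seq by <:].

Definition null_seq : {pred cauchy_seq} := fun u =>
  `[< forall n, exists k, forall i, (k <= i)%N -> m_exp n (val u i) >].

Lemma null_seq_ideal : idealr_closed null_seq.
Proof.
split=> [||a u v /asboolP u0 /asboolP v0].
- apply/asboolP => n; exists 0%N => i _; rewrite raddf0.
  by have [] := ideal_expP [set` m] n.
- apply/asboolP => /(_ 1%N)[k /(_ k (leqnn k))]; rewrite rmorph1.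
  move=> /(_ [set` m]) m1; suff: 1 \in m by rewrite idealr1.
  apply: m1; split=> [|_ [x mx [y _ <-]]]; last first.
    by rewrite /= mulrC; exact: idealMr.
  split=> [|b x y mx my]; first exact: idealr0.
  by apply: rpredD => //; exact: idealMr.
- apply/asboolP => n; have [k ku] := u0 n; have [k' kv] := v0 n.
  exists (maxn k k') => i; rewrite geq_max => /andP[ki k'i].
  rewrite rmorphD rmorphM; have [_ ID] := ideal_expP [set` m] n.
  by apply: ID; [apply: ku|apply: kv].
Qed.

HB.instance Definition _ := isIdealr.Build cauchy_seq null_seq null_seq_ideal.

Definition completion : comNzRingType := {ideal_quot null_seq}.

End Completion.

Definition burch_ring (R : comNzRingType) (m : idealr R) : Prop :=
  exists2 t, has_depth [set` m] t &
  exists (x : t.-tuple (completion m)) (J : idealr (completion m)),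
    [/\ maximal_regular_seq x, [set` J] = ideal_span [set` x] &
     exists (S : comNzRingType) (n : set S) (I : idealr S),
       [/\ regular_local_ring n, burch_ideal n [set` I] &
        exists f : {rmorphism {ideal_quot J} -> {ideal_quot I}}, bijective f]].

Section Modules.
Variable R : comNzRingType.

Definition fin_gen (M : lmodType R) : Prop :=
  exists (k : nat) (e : 'I_k -> M),
    forall v, exists c : 'I_k -> R, v = \sum_i c i *: e i.

Definition projective (P : lmodType R) : Prop :=
  forall (A B : lmodType R) (g : {linear A -> B}) (f : {linear P -> B}),
    (forall b, exists a, g a = b) ->
    exists h : {linear P -> A}, forall p, g (h p) = f p.

Record proj_resolution (M : lmodType R) := ProjResolution {
  res_mod :> nat -> lmodType R;
  res_diff : forall i, {linear res_mod i.+1 -> res_mod i};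
  res_aug : {linear res_mod 0%N -> M};
  res_projective : forall i, projective (res_mod i);
  res_aug_surj : forall v, exists p, res_aug p = v;
  res_aug_exact : forall p, res_aug p = 0 <-> exists q, res_diff 0 q = p;
  res_exact : forall i p, res_diff i p = 0 <-> exists q, res_diff i.+1 q = p
}.

Definition finite_proj_dim (M : lmodType R) : Prop :=
  exists (P : proj_resolution M) (k : nat),
    forall i, (k < i)%N -> forall p : P i, p = 0.

(* M (x)_R N: the free abelian group on M * N modulo the bilinearity relations *)
Section Tensor.
Variables M N : lmodType R.
Local Notation F := {freeg (M * N)%type / int}.

Definition additive_subgroup (A : set F) : Prop :=
  A 0 /\ forall z w, A z -> A w -> A (z - w).

Definition bilinear_rel : set F :=
  [set z | [\/ exists x x' y, z = << (x + x', y) >> - << (x, y) >> - << (x', y) >>,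
               exists x y y', z = << (x, y + y') >> - << (x, y) >> - << (x, y') >>
             | exists a x y, z = << (a *: x, y) >> - << (x, a *: y) >> ] ].

Definition tensor_ker : {pred F} := fun z =>
  `[< smallest additive_subgroup bilinear_rel z >].

Lemma tensor_ker_zmod : zmod_closed tensor_ker.
Proof.
split=> [|z w /asboolP zK /asboolP wK]; first by apply/asboolP => A [[]].
by apply/asboolP => A [sA rA]; apply: sA.2; [apply: zK|apply: wK].
Qed.

HB.instance Definition _ := GRing.isZmodClosed.Build F tensor_ker tensor_ker_zmod.

Definition tensor : zmodType := Quotient.quot tensor_ker.

Definition tensor_pi (z : F) : tensor := \pi_(Quotient.quot tensor_ker)%qT z.

Definition tensor_repr (z : tensor) : F := repr (z : Quotient.quot tensor_ker).

End Tensor.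

(* f (x) N, which sends the class of (x, y) to the class of (f x, y) *)
Definition tensor_map (M M' N : lmodType R) (f : {linear M -> M'})
    (z : tensor M N) : tensor M' N :=
  tensor_pi (fglift (fun xy => << (f xy.1, xy.2) >>) (tensor_repr z)).

(* H_i (P (x) N) = 0, stated as exactness at P_i (x) N *)
Definition tensor_homology_eq0 (M : lmodType R) (P : proj_resolution M)
    (N : lmodType R) (i : nat) : Prop :=
  match i with
  | 0 => forall z, exists w, tensor_map (N := N) (res_diff P 0) w = z
  | j.+1 => forall z, tensor_map (N := N) (res_diff P j) z = 0 ->
                exists w, tensor_map (N := N) (res_diff P j.+1) w = z
  end.

(* Tor_i(M, N) = 0; by the comparison theorem, any one resolution decides it *)
Definition Tor_eq0 (M N : lmodType R) (i : nat) : Prop :=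
  exists P : proj_resolution M, tensor_homology_eq0 P N i.

End Modules.

(* Main.v *)
(* Let F and G be minimal free resolutions of M and N. The vanishing of Tor   *)
(* says that H_i(F (x) coker(G_(t+1) -> G_t)) = 0 for l <= i <= l + t + 1.    *)
(* This passes to the completion by flatness, then to A = R^/(x_1, ..., x_t)  *)
(* = S/I, where each x_j costs one degree; over A both F and G are still exact in    *)
(* degrees > t, and H_i(F (x) N') = 0 for i = l + t, l + t + 1, with          *)
(* N' = coker(G_(t+1) -> G_t) over A.                                         *)
(* Truncate F at degree l + t - 3 >= t and let W be the pushout of            *)
(* 0 -> Omega -> F_0 along multiplication by x on Omega, where s x in I is    *)
(* not in n I for some s in (I : n) and x in n. The mapping cone resolves W,  *)
(* and two consecutive vanishing Tors give Tor_3(W, N') = 0. One entry of the *)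
(* first differential of the cone is x, so, unless F_1 = 0, the socle element *)
(* s e_j is a minimal generator of the second syzygy of W: k is a summand of  *)
(* it. Hence Tor_1(k, N') = 0 and G_(t+1) = 0.                                *)
Require Import Defs.
From HB Require Import structures.
From mathcomp Require Import all_boot all_order all_algebra.
From mathcomp Require Import boolp classical_sets.
From mathcomp Require Import freeg ring zify.

Set Implicit Arguments.
Unset Strict Implicit.
Unset Printing Implicit Defensive.

Import GRing.Theory.
Local Open Scope ring_scope.
Local Open Scope classical_set_scope.

(** The heart is [burch_rigidity], a statement about matrices over [A = S/I]. The Burch condition
    yields a socle element [s] and an element [x] of the maximal ideal with the obstruction stated
    in [burch_pair] ([burch_pair_exists]). In the cone of multiplication by [x] on a syzygy of [M],
    the cycle [(0, s e_j)] bounds some chain [(a, b)]. If the second complex has a nonzero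
    differential row [w], then [w] kills that boundary, so [(a, b)] tensored with [w] is again a
    cycle. Exactness and two consecutive vanishing Tors rewrite it with coefficients in the maximal
    ideal ([cone_tor]); minimality then puts [a] and [b] there too ([mxin_of_tensor_row]), which the
    Burch pair forbids ([cone_socle_unit]). The rest carries the hypotheses from [R] to [A]:
    [Tor_eq0_tor_vanishes] turns Tor into matrix equations, [tor_vanishes_shiftn] replaces [N] by a
    [t]-th syzygy, [completion_flat] (through [artin_rees]) and [tor_vanishes_flat] pass to the
    completion, and [exact_mod_regular] and [tor_vanishes_mod_regular] divide by the regular
    sequence. Base change keeps the ranks, so a rank that vanishes over [A] ends a minimal
    resolution over [R] ([finite_proj_dim_of_rank]). *)

(** * Matrices with entries in an ideal *)

Section Ideals.
Variables (A : comNzRingType) (I : set A).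
Hypothesis idI : ideal I.

Lemma ideal0 : I 0. Proof. exact: idI.1. Qed.

Lemma idealD x y : I x -> I y -> I (x + y).
Proof. by move=> Ix Iy; rewrite -[x]mul1r; apply: idI.2. Qed.

Lemma idealMl a x : I x -> I (a * x).
Proof. by move=> Ix; rewrite -[_ * _]addr0; apply: idI.2 => //; apply: idI.1. Qed.

Lemma idealMrr a x : I x -> I (x * a).
Proof. by rewrite mulrC; apply: idealMl. Qed.

Lemma idealN x : I x -> I (- x).
Proof. by rewrite -mulN1r; apply: idealMl. Qed.

Lemma idealB x y : I x -> I y -> I (x - y).
Proof. by move=> Ix Iy; apply: idealD => //; apply: idealN. Qed.

Lemma ideal_sum (J : finType) (P : pred J) (F : J -> A) :
  (forall i, P i -> I (F i)) -> I (\sum_(i | P i) F i).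
Proof. by move=> IF; apply: big_ind => //; [exact: ideal0|exact: idealD]. Qed.

Definition mxin p q (X : 'M[A]_(p, q)) := forall i j, I (X i j).

Lemma mxin0 p q : mxin (0 : 'M_(p, q)).
Proof. by move=> i j; rewrite mxE; apply: ideal0. Qed.

Lemma mxinD p q (X Y : 'M_(p, q)) : mxin X -> mxin Y -> mxin (X + Y).
Proof. by move=> IX IY i j; rewrite mxE; apply: idealD. Qed.

Lemma mxinN p q (X : 'M_(p, q)) : mxin X -> mxin (- X).
Proof. by move=> IX i j; rewrite mxE; apply: idealN. Qed.

Lemma mxinB p q (X Y : 'M_(p, q)) : mxin X -> mxin Y -> mxin (X - Y).
Proof. by move=> IX IY; apply: mxinD => //; apply: mxinN. Qed.

Lemma mxinZ p q a (X : 'M_(p, q)) : mxin X -> mxin (a *: X).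
Proof. by move=> IX i j; rewrite mxE; apply: idealMl. Qed.

Lemma mxinZl p q a (X : 'M_(p, q)) : I a -> mxin (a *: X).
Proof. by move=> Ia i j; rewrite mxE; apply: idealMrr. Qed.

Lemma mxinMl p q r (B : 'M_(p, q)) (X : 'M_(q, r)) : mxin X -> mxin (B *m X).
Proof. by move=> IX i j; rewrite mxE; apply: ideal_sum => k _; apply: idealMl. Qed.

Lemma mxinMr p q r (X : 'M_(p, q)) (B : 'M_(q, r)) : mxin X -> mxin (X *m B).
Proof. by move=> IX i j; rewrite mxE; apply: ideal_sum => k _; apply: idealMrr. Qed.

Lemma mxin_tr p q (X : 'M_(p, q)) : mxin X -> mxin X^T.
Proof. by move=> IX i j; rewrite mxE. Qed.

Lemma mxin_row p q (X : 'M_(p, q)) i : mxin X -> mxin (row i X).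
Proof. by move=> IX k j; rewrite mxE. Qed.

Lemma mxin_col p q (X : 'M_(p, q)) i : mxin X -> mxin (col i X).
Proof. by move=> IX k j; rewrite mxE. Qed.

Lemma mxin_row_mx p q r (X : 'M_(p, q)) (Y : 'M_(p, r)) :
  mxin X -> mxin Y -> mxin (row_mx X Y).
Proof. by move=> IX IY i j; rewrite mxE; case: splitP. Qed.

Lemma mxin_col_mx p q r (X : 'M_(p, r)) (Y : 'M_(q, r)) :
  mxin X -> mxin Y -> mxin (col_mx X Y).
Proof. by move=> IX IY i j; rewrite mxE; case: splitP. Qed.

End Ideals.

(** * Exactness and vanishing of Tor as matrix equations *)

Section Exactness.
Variable A : comNzRingType.

(* Matrices act on row vectors from the right: [A^c --C'--> A^b --C--> A^a]. *)
Definition exact a b c (C : 'M[A]_(b, a)) (C' : 'M[A]_(c, b)) :=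
  forall q (X : 'M_(q, b)), X *m C = 0 -> exists Y, X = Y *m C'.

(* [H_1 (F (x) coker E) = 0] for [F] given by [A^p2 --D1--> A^p1 --D0--> A^p0]. *)
Definition tor_vanishes p0 p1 p2 q0 q1 (D0 : 'M[A]_(p1, p0))
    (D1 : 'M[A]_(p2, p1)) (E : 'M[A]_(q1, q0)) :=
  forall X Y, D0^T *m X = Y *m E -> exists U V, X = D1^T *m U + V *m E.

(** An element of [F_i] tensored with a free module is a matrix whose rows are indexed by the basis
    of [F_i]; differentials of [F] then act on the left by transposes. *)
Lemma exact_tr a b c (C : 'M[A]_(b, a)) (C' : 'M_(c, b)) q (X : 'M_(b, q)) :
  exact C C' -> C^T *m X = 0 -> exists Y, X = C'^T *m Y.
Proof.
move=> ex CX; have [|Y XY] := ex _ X^T.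
  by rewrite -[C]trmxK -trmx_mul CX trmx0.
by exists Y^T; rewrite -trmx_mul -XY trmxK.
Qed.

(** Dimension shifting in the second argument: [coker E1] is the first syzygy of [coker E0], so
    homology with coefficients in it sits one degree lower. *)
Lemma tor_vanishes_shift p0 p1 p2 p3 q0 q1 q2 (D0 : 'M[A]_(p1, p0))
    (D1 : 'M_(p2, p1)) (D2 : 'M_(p3, p2)) (E0 : 'M_(q1, q0)) (E1 : 'M_(q2, q1)) :
  D2 *m D1 = 0 -> E1 *m E0 = 0 -> exact D0 D1 -> exact E0 E1 ->
  tor_vanishes D1 D2 E0 -> tor_vanishes D0 D1 E1.
Proof.
move=> D21 E10 exD exE tv X Y DX.
have [|X' XX'] := exact_tr exD (X := X *m E0).
  by rewrite mulmxA DX -mulmxA E10 mulmx0.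
have [U [V X'E]] := tv X' X (esym XX').
have [|V' XV'] := exE _ (X - D1^T *m V).
  rewrite mulmxBl XX' X'E mulmxDr !mulmxA -trmx_mul D21 trmx0 mul0mx add0r.
  exact: subrr.
by exists V, V'; rewrite -XV' addrC subrK.
Qed.

End Exactness.

(** * Division by a regular element *)

Section ExactnessMod.
Variables (A : comNzRingType) (I : set A).
Hypothesis idI : ideal I.

(** Exactness over the quotient by [I], phrased with lifts, so that one ring serves all stages of a
    regular sequence. *)
Definition exact_mod a b c (C : 'M[A]_(b, a)) (C' : 'M[A]_(c, b)) :=
  forall q (X : 'M_(q, b)), mxin I (X *m C) -> exists Y, mxin I (X - Y *m C').

Definition tor_vanishes_mod p0 p1 p2 q0 q1 (D0 : 'M[A]_(p1, p0))
    (D1 : 'M[A]_(p2, p1)) (E : 'M[A]_(q1, q0)) :=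
  forall X Y, mxin I (D0^T *m X - Y *m E) ->
    exists U V, mxin I (X - (D1^T *m U + V *m E)).

Variables (I' : set A) (x : A).
Hypothesis I'E : forall a, I' a <-> exists2 b, I b & exists c, a = b + x * c.
Hypothesis x_regular : forall a, I (x * a) -> I a.

Lemma mxin_adjoin p q (X : 'M[A]_(p, q)) :
  mxin I' X <-> exists Z, mxin I (X - x *: Z).
Proof.
split=> [I'X|[Z XZ] i j].
  have /choice[Z XZ] : forall ij, exists c, I (X ij.1 ij.2 - x * c).
    by move=> [i j]; have /I'E[b Ib [c ->]] := I'X i j; exists c; rewrite addrK.
  by exists (\matrix_(i, j) Z (i, j)) => i j; rewrite !mxE; apply: (XZ (i, j)).
apply/I'E; exists ((X - x *: Z) i j) => //.
by exists (Z i j); rewrite !mxE subrK.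
Qed.

Lemma mxin_regular p q (X : 'M[A]_(p, q)) : mxin I (x *: X) -> mxin I X.
Proof. by move=> IX i j; apply: x_regular; have := IX i j; rewrite mxE. Qed.

(** The long exact sequence of multiplication by [x], by hand: a cycle [X] modulo [I'] has boundary
    [x Z], regularity makes [Z] a cycle, hence [Z = U C1], and [X - x U] is a cycle modulo [I]. *)
Lemma exact_mod_adjoin a b c d (C0 : 'M[A]_(b, a)) (C1 : 'M_(c, b))
    (C2 : 'M_(d, c)) : C1 *m C0 = 0 ->
  exact_mod C0 C1 -> exact_mod C1 C2 ->
  forall q (X : 'M_(q, c)), mxin I' (X *m C1) ->
    exists Y, mxin I' (X - Y *m C2).
Proof.
move=> C10 ex0 ex1 q X /mxin_adjoin[Z XZ].
have [|U ZU] := ex0 _ Z.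
  apply: mxin_regular; have /(mxinN idI) := mxinMr idI C0 XZ.
  by rewrite mulmxBl -mulmxA C10 mulmx0 sub0r opprK -scalemxAl.
have [|Y XY] := ex1 _ (X - x *: U).
  have /(mxinD idI XZ) := mxinZ idI x ZU.
  by rewrite scalerBr addrA subrK mulmxBl -scalemxAl.
by exists Y; apply/mxin_adjoin; exists U; rewrite addrAC.
Qed.

(** The same argument with coefficients in [coker E1]. Exactness of [E0], [E1] embeds this cokernel
    in a free module over the quotient, so [x] stays regular on it. *)
Lemma tor_vanishes_adjoin p0 p1 p2 p3 q0 q1 q2 (D0 : 'M[A]_(p1, p0))
    (D1 : 'M_(p2, p1)) (D2 : 'M_(p3, p2)) (E0 : 'M_(q1, q0)) (E1 : 'M_(q2, q1)) :
  D1 *m D0 = 0 -> E1 *m E0 = 0 -> exact_mod E0 E1 ->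
  tor_vanishes_mod D0 D1 E1 -> tor_vanishes_mod D1 D2 E1 ->
  forall X Y, mxin I' (D1^T *m X - Y *m E1) ->
    exists U V, mxin I' (X - (D2^T *m U + V *m E1)).
Proof.
move=> D10 E10 exE tv0 tv1 X Y /mxin_adjoin[Z XZ].
have [|Y' ZY'] := exE _ (D0^T *m Z).
  apply: mxin_regular; have /(mxinN idI) := mxinMl idI D0^T (mxinMr idI E0 XZ).
  rewrite !mulmxBl -[Y *m _ *m _]mulmxA E10 mulmx0 subr0 mulmxBr !mulmxA.
  rewrite -trmx_mul D10 trmx0 !mul0mx sub0r opprK.
  by rewrite -scalemxAr -scalemxAl.
have [U [V ZE]] := tv0 _ _ ZY'.
have [|U' [V' XE]] := tv1 (X - x *: U) (Y + x *: V).
  have /(mxinD idI XZ) := mxinZ idI x ZE.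
  rewrite scalerBr addrA subrK scalerDr mulmxBr mulmxDl -!scalemxAr -!scalemxAl.
  by rewrite !opprD !addrA [X in mxin _ (X - _)]addrAC.
by exists U', V'; apply/mxin_adjoin; exists U; rewrite addrAC.
Qed.

End ExactnessMod.

(** * From congruences modulo [I] to equations in the quotient ring *)

Section Quotient.
Variables (B A : comNzRingType) (I : set B) (g : {rmorphism B -> A}).
Hypothesis g_surj : forall y, exists x, g x = y.
Hypothesis g_ker : forall x, g x = 0 <-> I x.

Lemma mxin_ker p q (X : 'M[B]_(p, q)) : mxin I X <-> map_mx g X = 0.
Proof.
split=> [IX|/matrixP gX i j]; last by apply/g_ker; have := gX i j; rewrite !mxE.
by apply/matrixP=> i j; rewrite !mxE; apply/g_ker.
Qed.

Lemma map_mx_surj p q (Y : 'M[A]_(p, q)) : exists X, Y = map_mx g X.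
Proof.
have [h hK] := choice g_surj; exists (map_mx h Y).
by apply/matrixP => i j; rewrite !mxE hK.
Qed.

Lemma exact_quotient a b c (C : 'M[B]_(b, a)) (C' : 'M_(c, b)) :
  exact_mod I C C' -> exact (map_mx g C) (map_mx g C').
Proof.
move=> ex q X; have [X' ->] := map_mx_surj X.
rewrite -map_mxM => /mxin_ker/ex[Y /mxin_ker/eqP].
by rewrite map_mxB map_mxM subr_eq0 => /eqP; exists (map_mx g Y).
Qed.

Lemma tor_vanishes_quotient p0 p1 p2 q0 q1 (D0 : 'M[B]_(p1, p0))
    (D1 : 'M_(p2, p1)) (E : 'M_(q1, q0)) :
  tor_vanishes_mod I D0 D1 E ->
  tor_vanishes (map_mx g D0) (map_mx g D1) (map_mx g E).
Proof.
move=> tv X Y; have [X' ->] := map_mx_surj X; have [Y' ->] := map_mx_surj Y.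
move=> XY; have [|U [V /mxin_ker/eqP]] := tv X' Y'.
  by apply/mxin_ker; rewrite map_mxB !map_mxM -map_trmx XY subrr.
rewrite map_mxB map_mxD !map_mxM -map_trmx subr_eq0 => /eqP ->.
by exists (map_mx g U), (map_mx g V).
Qed.

End Quotient.

(* If [A = S / I] and [s], [x] lift to [s'], [x'] with [s' x' \notin n I],     *)
(* where [n] maps onto [m], then a row vector [r] over [m] with [r_j = x]     *)
(* cannot have [s e_j] in [m (Ker r)]: this is the last clause.                *)
Definition burch_pair (A : comNzRingType) (m : set A) (s x : A) :=
  [/\ m x, forall a, m a -> a * s = 0 &
   forall n k (r : 'cV[A]_n) (W : 'M_(k, n)) (a : 'rV_k) (j : 'I_n),
     mxin m r -> mxin m a -> W *m r = 0 -> r j 0 = x ->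
     a *m W <> s *: delta_mx 0 j].

(** * Rigidity over a ring with a Burch pair *)

Section Rigidity.
Variables (A : comNzRingType) (m : set A) (s x : A).
Hypotheses (idm : ideal m) (m1 : ~ m 1).
Hypothesis m_units : forall a, ~ m a -> exists b, b * a = 1.
Hypothesis burch : burch_pair m s x.

Variables (n0 n1 n2 n3 n4 n5 q0 q1 q2 : nat).
Variables (f0 : 'M[A]_(n1, n0)) (f1 : 'M[A]_(n2, n1)) (f2 : 'M[A]_(n3, n2)).
Variables (f3 : 'M[A]_(n4, n3)) (f4 : 'M[A]_(n5, n4)).
Variables (E : 'M[A]_(q1, q0)) (E' : 'M[A]_(q2, q1)).
Hypotheses (mf0 : mxin m f0) (mf1 : mxin m f1) (mf2 : mxin m f2) (mf3 : mxin m f3).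
Hypotheses (mE : mxin m E) (mE' : mxin m E').
Hypotheses (f21 : f2 *m f1 = 0) (f32 : f3 *m f2 = 0).
Hypothesis (f43 : f4 *m f3 = 0).
Hypotheses (ex0 : exact f0 f1) (ex1 : exact f1 f2) (ex2 : exact f2 f3).
Hypothesis exE : exact E E'.
Hypotheses (tor3 : tor_vanishes f2 f3 E) (tor4 : tor_vanishes f3 f4 E).

Lemma socle_mxZ p q (X : 'M[A]_(p, q)) : mxin m X -> s *: X = 0.
Proof.
have [_ ms _] := burch.
by move=> mX; apply/matrixP => i j; rewrite !mxE mulrC ms.
Qed.

(* A pair [(a, b)] is a chain of the cone of multiplication by [x] on a        *)
(* syzygy, with differential [(a, b) |-> (x b - a h1, b h0)].                  *)
Lemma cone_exact k0 k1 k2 k3 (h0 : 'M[A]_(k1, k0)) (h1 : 'M_(k2, k1))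
    (h2 : 'M_(k3, k2)) q (a : 'M_(q, k2)) (b : 'M_(q, k1)) :
  exact h0 h1 -> exact h1 h2 -> b *m h0 = 0 -> x *: b = a *m h1 ->
  exists a' b', a = x *: b' - a' *m h2 /\ b = b' *m h1.
Proof.
move=> exh0 exh1 bh0 xb; have [b' bE] := exh0 _ _ bh0.
have [|a' aE] := exh1 _ (x *: b' - a).
  by rewrite mulmxBl -scalemxAl -bE xb subrr.
by exists a', b'; rewrite -aE subKr.
Qed.

(** A cycle of the cone with coefficients in [coker E] is corrected first in [Xb] by [tor3], then in
    [Xa - x U] by [tor4]. The point is the shape of the result: the factors of [E] involve [x], [f3]
    and [f2], hence lie over [m]. *)
Lemma cone_tor (Xa : 'M_(n4, q0)) (Xb : 'M_(n3, q0)) Ya Yb :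
  - (f3^T *m Xa) + x *: Xb = Ya *m E -> f2^T *m Xb = Yb *m E ->
  exists V V', - (f3^T *m Xa) + x *: Xb = (x *: V - f3^T *m V') *m E /\
               f2^T *m Xb = f2^T *m V *m E.
Proof.
move=> eqa eqb; have [U [V XbE]] := tor3 eqb.
have [|U' [V' XaE]] := tor4 (X := Xa - x *: U) (Y := x *: V - Ya).
  rewrite mulmxBl -eqa XbE mulmxBr scalerDr -scalemxAr -scalemxAl.
  move: (f3^T *m Xa) (x *: (f3^T *m U)) (x *: (V *m E)) => P Q T.
  by apply/matrixP => k l; rewrite !mxE; ring.
exists V, V'; split; last first.
  by rewrite XbE mulmxDr !mulmxA -trmx_mul f32 trmx0 mul0mx add0r.
rewrite -[Xa](subrK (x *: U)) XaE XbE !mulmxDr !mulmxA -trmx_mul f43 trmx0.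
rewrite mul0mx add0r mulmxBl scalerDr -scalemxAl -scalemxAr.
move: (f3^T *m V' *m E) (x *: (f3^T *m U)) (x *: (V *m E)) => P Q T.
by apply/matrixP => k l; rewrite !mxE; ring.
Qed.

(* The cone chain [(a, b)] has the socle element [(0, s e_j)] as its boundary. *)
Lemma cone_socle_unit (j : 'I_n1) (a : 'rV_n3) (b : 'rV_n2) :
  a *m f2 = x *: b -> b *m f1 = s *: delta_mx 0 j -> mxin m a -> mxin m b -> False.
Proof.
have [mx ms bu] := burch; move=> ab bf ma mb.
(* [W] is the cone differential on the pairs [(a, b)], and [r] is one column of the next one,
   [(u, v) |-> x v - u f1] at coordinate [j]; so [W r = 0], and the entry of [r] facing [s e_j] is
   [x]. *)
pose r := col_mx (- col j f1) (x *: delta_mx j 0) : 'cV_(n2 + n1).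
pose W := block_mx (- f2) 0 (x%:M) f1.
apply: (bu _ _ r W (row_mx a b) (rshift n2 j)).
- apply: mxin_col_mx; first by apply: mxinN => //; apply: mxin_col.
  exact: mxinZl.
- exact: mxin_row_mx.
- rewrite mul_block_col mul0mx addr0 mulNmx mulmxN opprK colE mulmxA f21.
  by rewrite mul0mx mul_scalar_mx -scalemxAr scalerN addNr col_mx0.
- by rewrite col_mxEd !mxE !eqxx mulr1.
- rewrite mul_row_block mulmx0 add0r bf mulmxN mul_mx_scalar ab addNr.
  apply/matrixP => i k; rewrite !mxE.
  case: splitP => [k' kk'|k' kk']; rewrite !mxE.
    have /negPf -> : k != rshift n2 j by rewrite -val_eqE /= kk' ltn_eqF // ltn_addr.
    by rewrite andbF mulr0.
  by rewrite -[k == _]val_eqE /= kk' eqn_add2l.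
Qed.

(** The rows of [E] are minimal generators, their syzygies [E'] being over [m]: a unit entry of [y]
    would write row [i] as an [m]-combination of the rows of [E]. *)
Lemma mxin_of_tensor_row p (y : 'rV_p) (G : 'M_(p, q1)) (i : 'I_q1) :
  mxin m G -> y^T *m row i E = G *m E -> mxin m y.
Proof.
move=> mG yE k0 k; rewrite ord1; apply: contrapT => /m_units[v vy].
have [|Y YE'] := exE (X := delta_mx 0 i - v *: row k G).
  rewrite mulmxBl -rowE -scalemxAl -row_mul -yE row_mul.
  rewrite [row k y^T](_ : _ = (y 0 k)%:M); last first.
    by apply/rowP => l; rewrite !ord1 !mxE eqxx.
  by rewrite mul_scalar_mx scalerA vy scale1r subrr.
apply: m1; rewrite -[1](subrK (v * G k i)); apply: idealD => //; last exact: idealMl.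
have /matrixP/(_ 0 i) := YE'; rewrite !mxE !eqxx /= => ->.
by have := mxinMl idm Y mE' 0 i; rewrite mxE.
Qed.

Lemma burch_rigidity : n1 = 0%N \/ q1 = 0%N.
Proof.
have [mx ms bu] := burch.
have [->|n1_gt0] := posnP n1; first by left.
right; have [//|q1_gt0] := posnP q1; exfalso.
pose j := Ordinal n1_gt0; pose i := Ordinal q1_gt0.
(* The pair [(0, s e_j)] is a cycle of the cone because [s] kills [x] and the entries of [f0]. *)
have [||a [b [/eqP ab bE]]] := @cone_exact _ _ _ _ f0 f1 f2 1
    0 (s *: delta_mx 0 j) ex0 ex1.
- by rewrite -scalemxAl -rowE; apply: socle_mxZ; apply: mxin_row.
- by rewrite scalerA ms // scale0r mul0mx.
rewrite eq_sym subr_eq0 in ab; move/eqP: ab => ab.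
pose w := row i E; have mw : mxin m w by apply: mxin_row.
(* Tensoring with [w] kills the boundary [s e_j], since [w] is over [m]; a cycle results, which is
   bounded by [(Qa, Qb)]. *)
have [||Qa [Qb [aE bE']]] := @cone_exact _ _ _ _ f1 f2 f3 q0
    (w^T *m a) (w^T *m b) ex1 ex2.
- by rewrite -mulmxA -bE -scalemxAr scalemxAl socle_mxZ ?mul0mx //; apply: mxin_tr.
- by rewrite -mulmxA -ab -scalemxAr.
have aE' : - (f3^T *m Qa^T) + x *: Qb^T = a^T *m w.
  have -> : a^T *m w = (w^T *m a)^T by rewrite trmx_mul trmxK.
  by rewrite aE linearB linearZ /= trmx_mul addrC.
have bE'' : f2^T *m Qb^T = b^T *m w by rewrite -trmx_mul -bE' trmx_mul trmxK.
(* Modulo the rows of [E] the chain [(Qa, Qb)] is itself a cycle: its boundary is a multiple of [w],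
   a row of [E]. *)
have [||V [V' []]] := @cone_tor Qa^T Qb^T (a^T *m delta_mx 0 i) (b^T *m delta_mx 0 i).
- by rewrite aE' -mulmxA -rowE.
- by rewrite bE'' -mulmxA -rowE.
rewrite aE' bE'' => aw bw.
apply: (cone_socle_unit (esym ab) (esym bE)).
  apply: mxin_of_tensor_row aw; apply: mxinB; [exact: idm|exact: mxinZl|].
  by apply: mxinMr => //; apply: mxin_tr.
by apply: mxin_of_tensor_row bw; apply: mxinMr => //; apply: mxin_tr.
Qed.

End Rigidity.

(** * Zorn's lemma, spans and powers of ideals, units of a local ring *)

Lemma Zorn_above T (P : set (set T)) (X0 : set T) : P X0 ->
  (forall F : set (set T), F `<=` P -> total_on F subset -> F !=set0 ->
     P (\bigcup_(X in F) X)) ->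
  exists2 L, P L & forall L', P L' -> L `<=` L' -> L' `<=` L.
Proof.
move=> PX0 Pcup.
(* The first disjunct admits the empty chain, whose union [set0] need not satisfy [P]. *)
have [F FP totF|L [PL maxL]] := @Zorn_bigcup T (fun X => X = set0 \/ P X).
  have [[X [FX PX]]|noX] := pselect (exists X, F X /\ P X); last first.
    left; apply/seteqP; split=> // z [X FX Xz].
    by case: (FP X FX) => [X0'|PX]; [move: Xz; rewrite X0'|case: noX; exists X].
  right; rewrite (_ : \bigcup_(Y in F) Y = \bigcup_(Y in F `&` P) Y).
    by apply: Pcup => [Y [] //|Y Z [FY _] [FZ _]|]; [exact: totF|exists X].
  apply/seteqP; split=> z [Y FY Yz]; last by exists Y => //; case: FY.
  by exists Y => //; split=> //; case: (FP Y FY) Yz => // ->.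
have {}PL : P L.
  case: PL => // L0; suff <- : X0 = L by [].
  rewrite L0; apply: contrapT => X0n; apply: (maxL X0); last by right.
  by rewrite L0; split=> [//|X00]; apply: X0n; apply/seteqP; split.
exists L => // L' PL' LL'; apply: contrapT => nL'L.
by apply: (maxL L'); [split|right].
Qed.

Section Spans.
Variable R : comNzRingType.
Implicit Types (I J : set R) (s : seq R).

Lemma sub_ideal_span (X : set R) : X `<=` ideal_span X.
Proof. by move=> a Xa I [_]; apply. Qed.

Lemma ideal_span_sub (X : set R) I : ideal I -> X `<=` I -> ideal_span X `<=` I.
Proof. by move=> idI XI a; apply. Qed.

Lemma ideal_span_nil a : ideal_span [set` ([::] : seq R)] a <-> a = 0.
Proof.
split=> [|->]; last exact: (ideal_spanP _).1.
apply: (ideal_span_sub (I := [set 0])); last by [].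
by split=> // b _ _ -> ->; rewrite mulr0 addr0.
Qed.

Lemma ideal_span_adjoin (X : set R) (Y : set R) y :
  (forall z, Y z <-> z = y \/ X z) -> forall a,
  ideal_span Y a <-> exists2 b, ideal_span X b & exists c, a = b + y * c.
Proof.
move=> YE a; have idX := ideal_spanP X; have idY := ideal_spanP Y.
split=> [|[b Xb [c ->]]]; last first.
  apply: (idealD idY); last first.
    by apply: (idealMrr idY); apply: sub_ideal_span; apply/YE; left.
  move: Xb; apply: (ideal_span_sub idY).
  by move=> z Xz; apply: sub_ideal_span; apply/YE; right.
apply: (ideal_span_sub (I := [set a | exists2 b, _ b & exists c, a = b + y * c])).
  split=> [|d _ _ [b Xb [c ->]] [b' Xb' [c' ->]]].
    by exists 0; [exact: idX.1|exists 0; rewrite mulr0 addr0].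
  exists (d * b + b'); first exact: idX.2.
  by exists (d * c + c'); ring.
move=> z /YE[->|Xz].
  by exists 0; [exact: idX.1|exists 1; rewrite mulr1 add0r].
by exists z; [exact: sub_ideal_span|exists 0; rewrite mulr0 addr0].
Qed.

Lemma ideal_span_cons y s a : ideal_span [set` y :: s] a <->
  exists2 b, ideal_span [set` s] b & exists c, a = b + y * c.
Proof.
apply: ideal_span_adjoin => z /=; rewrite inE.
by split=> [/predU1P//|H]; apply/predU1P.
Qed.

Lemma ideal_span_rcons y s a : ideal_span [set` rcons s y] a <->
  exists2 b, ideal_span [set` s] b & exists c, a = b + y * c.
Proof.
apply: ideal_span_adjoin => z /=; rewrite mem_rcons inE.
by split=> [/predU1P//|H]; apply/predU1P.
Qed.

Lemma ideal_span_seq s a : ideal_span [set` s] a ->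
  exists r : 'I_(size s) -> R, a = \sum_i r i * s`_i.
Proof.
apply: (ideal_span_sub
  (I := [set a | exists r : 'I_(size s) -> R, a = \sum_i r i * s`_i])).
  split=> [|b _ _ [r ->] [r' ->]].
    by exists (fun=> 0); rewrite big1 // => i _; rewrite mul0r.
  exists (fun i => b * r i + r' i); rewrite mulr_sumr -big_split.
  by apply: eq_bigr => i _ /=; rewrite mulrDl mulrA.
move=> z /= zs; have iz : (index z s < size s)%N by rewrite index_mem.
exists (fun i => (i == Ordinal iz)%:R).
rewrite (bigD1 (Ordinal iz)) //= eqxx mul1r nth_index // big1 ?addr0 //.
by move=> i /negPf ->; rewrite mul0r.
Qed.

Lemma ideal_expS_ind I n (P : set R) : ideal P ->
  (forall a b, I a -> ideal_exp I n b -> P (a * b)) -> ideal_exp I n.+1 `<=` P.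
Proof. by move=> idP IP; apply: ideal_span_sub => // _ [a Ia [b Ib <-]]; apply: IP. Qed.

Lemma ideal_expM I n a b : I a -> ideal_exp I n b -> ideal_exp I n.+1 (a * b).
Proof. by move=> Ia Ib; apply: sub_ideal_span; exists a => //; exists b. Qed.

Lemma ideal_exp_pow I n a : I a -> ideal_exp I n (a ^+ n).
Proof.
by move=> Ia; elim: n => [//|n IHn]; rewrite exprS; apply: ideal_expM.
Qed.

Lemma ideal_expSS I n : ideal_exp I n.+1 `<=` ideal_exp I n.
Proof.
by apply: (ideal_expS_ind (ideal_expP I n)) => a b _; apply: (idealMl (ideal_expP I n)).
Qed.

Lemma ideal_exp_le I n k : (n <= k)%N -> ideal_exp I k `<=` ideal_exp I n.
Proof.
move=> /subnK <-; elim: (k - n)%N => [//|d IHd] a; rewrite addSn.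
by move=> /ideal_expSS; apply: IHd.
Qed.

Lemma ideal_exp1 I : ideal I -> ideal_exp I 1 = I.
Proof.
move=> idI; apply/seteqP; split.
  by apply: (ideal_expS_ind idI) => a b Ia _; apply: (idealMrr idI).
by move=> a Ia; rewrite -[a]mulr1; apply: ideal_expM.
Qed.

Lemma ideal_exp_sub_of_pow s I : ideal I ->
  (forall y, y \in s -> exists k, I (y ^+ k)) ->
  exists k, ideal_exp (ideal_span [set` s]) k `<=` I.
Proof.
move=> idI; elim: s => [_|y s IHs Is].
  exists 1%N; apply: (ideal_expS_ind idI) => a b /ideal_span_nil -> _.
  by rewrite mul0r; apply: ideal0.
have [|K sK] := IHs; first by move=> z zs; apply: Is; rewrite inE zs orbT.
have [|k yk] := Is y; first exact: mem_head.
(* Pigeonhole: [i] counts factors [y], [j] factors from the span of [s], and [r] factors still to be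
   expanded. When [r] is 0, either [i >= k] or [j >= K]. *)
have main r : forall i j b w, (k + K <= i + j + r)%N ->
    ideal_exp (ideal_span [set` s]) j b ->
    ideal_exp (ideal_span [set` y :: s]) r w -> I (y ^+ i * b * w).
  elim: r => [|r IHr] i j b w le_ij jb.
    move=> _; apply: idealMrr => //; have [le_ki|lt_ik] := leqP k i.
      by rewrite -(subnK le_ki) exprD -!mulrA; apply: idealMl => //; apply: idealMrr.
    apply: idealMl => //; apply: sK; apply: ideal_exp_le jb.
    by rewrite -(leq_add2l k) (leq_trans le_ij) // addn0 leq_add2r ltnW.
  move: w; apply: ideal_expS_ind.
    split=> [|a u v Iu Iv]; first by rewrite /= mulr0; apply: ideal0.
    by rewrite /= mulrDr mulrCA; apply: idI.2.
  move=> _ w /ideal_span_cons[b' sb' [c ->]] rw /=.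
  have -> : y ^+ i * b * ((b' + y * c) * w) =
            y ^+ i * (b' * b) * w + c * (y ^+ i.+1 * b * w) by rewrite exprS; ring.
  apply: idealD => //; last apply: idealMl => //.
    apply: (IHr i j.+1) => //; first by rewrite addnS addSn -addnS.
    exact: ideal_expM.
  by apply: (IHr i.+1 j) => //; rewrite !addSn -addnS.
exists (k + K)%N => w rw; have := main _ 0%N 0%N 1 w (leqnn _) Logic.I rw.
by rewrite expr0 !mul1r.
Qed.

(** A maximal proper ideal above the principal ideal of a non-unit exists by Zorn and can only be
    [m]. *)
Lemma local_ring_unit (m : set R) : local_ring m ->
  forall a, ~ m a -> exists b, b * a = 1.
Proof.
move=> [_ _ m_unique] a nma; apply: contrapT => na1; apply: nma.
pose I0 := [set c | exists b, c = b * a].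
have [|F FP totF [X0 FX0]|J [idJ J1 IJ] maxJ] :=
    @Zorn_above R (fun I => [/\ ideal I, ~ I 1 & I0 `<=` I]) I0.
- split=> //; last by move=> [b b1]; apply: na1; exists b.
  split=> [|d _ _ [b ->] [b' ->]]; first by exists 0; rewrite mul0r.
  by exists (d * b + b'); ring.
- split; last first.
  + by move=> c I0c; exists X0 => //; have [_ _] := FP _ FX0; apply.
  + by move=> [X FX X1]; have [_] := FP _ FX.
  split=> [|d u v [X FX Xu] [Y FY Yv]].
    by exists X0 => //; have [[]] := FP _ FX0.
  have [XY|YX] := totF _ _ FX FY.
    by exists Y => //; have [[_ Yd] _ _] := FP _ FY; apply: Yd => //; apply: XY.
  by exists X => //; have [[_ Xd] _ _] := FP _ FX; apply: Xd => //; apply: YX.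
rewrite -(m_unique J); first by apply: IJ; exists 1; rewrite mul1r.
split=> // I idI I1 JI; apply/seteqP; split=> //.
by apply: maxJ => //; split=> // c I0c; apply/JI/IJ.
Qed.

End Spans.

(** * Finite generation of submodules and the Artin-Rees lemma *)

Section Noetherian.
Variable R : comNzRingType.

Definition submod (V : lmodType R) (K : set V) :=
  K 0 /\ forall a u v, K u -> K v -> K (a *: u + v).

Lemma submod_sum (V : lmodType R) (K : set V) (J : finType) (c : J -> R) (e : J -> V) :
  submod K -> (forall i, K (e i)) -> K (\sum_i c i *: e i).
Proof.
by move=> [K0 KD] Ke; apply: big_rec => // i v _ Kv; apply: KD.
Qed.

Lemma submod_mulmx n c (K : set 'rV[R]_n) (V : 'M_(c, n)) (r : 'rV_c) :
  submod K -> (forall i, K (row i V)) -> K (r *m V).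
Proof. by move=> sK KV; rewrite mulmx_sum_row; apply: submod_sum. Qed.

Hypothesis noethR : noetherian R.

(** Induction on [n]: the leading coordinates form a finitely generated ideal, and lifts of its
    generators are completed by generators of the part with leading coordinate 0. *)
Lemma submod_fin_gen n (K : set 'rV[R]_n) : submod K ->
  exists c (V : 'M_(c, n)), forall u, K u <-> exists r, u = r *m V.
Proof.
elim: n K => [|n IHn] K.
  move=> sK; exists 0%N, 0 => u; split=> _; first by exists 0; rewrite !thinmx0.
  by rewrite thinmx0; apply: sK.1.
rewrite -[n.+1]/(1 + n)%N in K *; move=> sK.
pose I := [set a | exists2 u : 'rV_(1 + n), K u & u 0 0 = a].
have idI : ideal I.
  split=> [|a _ _ [u Ku <-] [v Kv <-]]; first by exists 0; [exact: sK.1|rewrite mxE].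
  by exists (a *: u + v); [exact: sK.2|rewrite !mxE].
have [s IE] := noethR idI.
have /choice[w wP] : forall i : 'I_(size s), exists u : 'rV_(1 + n), K u /\ u 0 0 = s`_i.
  move=> i; have : I s`_i by rewrite IE; apply: sub_ideal_span; apply: mem_nth.
  by move=> [u Ku <-]; exists u.
have sK' : submod [set v : 'rV_n | K (row_mx 0 v : 'rV_(1 + n))].
  split=> [|a u v Ku Kv] /=; first by rewrite row_mx0; apply: sK.1.
  have -> : row_mx 0 (a *: u + v) = a *: (row_mx 0 u : 'rV_(1 + n)) + row_mx 0 v.
    by rewrite scale_row_mx add_row_mx scaler0 addr0.
  exact: sK.2.
have [c [V VP]] := IHn _ sK'.
exists (size s + c)%N, (col_mx (\matrix_i w i) (row_mx 0 V)) => u; split; last first.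
  move=> [r ->]; apply: submod_mulmx => // i; rewrite -[i]splitK.
  case: (fintype.split i) => k /=; rewrite (rowKu, rowKd) ?rowK; first by have [] := wP k.
  by rewrite row_row_mx row0; apply/VP; exists (delta_mx 0 k); rewrite -rowE.
move=> Ku; have : I (u 0 0) by exists u.
rewrite IE => /ideal_span_seq[r ur].
pose v : 'rV_(1 + n) := u - (\row_i r i) *m \matrix_i w i.
have Kv : K v.
  rewrite /v addrC -scaleN1r; apply: sK.2 => //.
  by apply: submod_mulmx => // i; rewrite rowK; have [] := wP i.
have vE : v = row_mx 0 (rsubmx v).
  rewrite -[LHS]hsubmxK; congr row_mx; apply/rowP => k; rewrite ord1 !mxE.
  rewrite (_ : lshift n 0 = 0); last exact/val_inj.
  rewrite ur -sumrB big1 // => i _; rewrite !mxE.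
  by have [_ ->] := wP i; rewrite subrr.
have /VP[r' r'E] : K (row_mx 0 (rsubmx v) : 'rV_(1 + n)) by rewrite -vE.
exists (row_mx (\row_i r i) r'); rewrite mul_row_col mul_mx_row mulmx0 -r'E -vE.
by rewrite addrC subrK.
Qed.

Variable m : set R.
Hypothesis idm : ideal m.

(* Instead of the Rees algebra, take [L] maximal among the submodules whose    *)
(* trace on the row space of [V] is [m^N V]; for [y] in [m], maximality forces *)
(* [y^k R^n <= L] for some [k], hence [m^k R^n <= L] for some [k].             *)
Lemma artin_rees c n (V : 'M[R]_(c, n)) N : exists k, forall r : 'rV_c,
  mxin (ideal_exp m k) (r *m V) ->
  exists2 r', mxin (ideal_exp m N) r' & r' *m V = r *m V.
Proof.
have idmN := ideal_expP m N.
pose L0 := [set u : 'rV_n | exists2 r, mxin (ideal_exp m N) r & r *m V = u].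
have [|F FP totF [X0 FX0]|L [sL L0L LV] maxL] :=
    @Zorn_above 'rV_n (fun L =>
      [/\ submod L, L0 `<=` L & forall r, L (r *m V) -> L0 (r *m V)]) L0.
- split=> //; split=> [|a _ _ [r mr <-] [r' mr' <-]].
    by exists 0; [exact: mxin0|rewrite mul0mx].
  exists (a *: r + r'); last by rewrite mulmxDl scalemxAl.
  by apply: mxinD => //; apply: mxinZ.
- split.
  + split=> [|d u v [X FX Xu] [Y FY Yv]].
      by exists X0 => //; have [[]] := FP _ FX0.
    have [XY|YX] := totF _ _ FX FY.
      by exists Y => //; have [[_ Yd] _ _] := FP _ FY; apply: Yd => //; apply: XY.
    by exists X => //; have [[_ Xd] _ _] := FP _ FX; apply: Xd => //; apply: YX.
  + by move=> u L0u; exists X0 => //; have [_ + _] := FP _ FX0; apply.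
  + by move=> r [X FX]; have [_ _] := FP _ FX; apply.
have Lpow y : m y -> exists k, forall v, L (y ^+ k *: v).
  move=> my.
  have LD i j v : L (y ^+ i *: v) -> L (y ^+ (j + i) *: v).
    move=> Lv; rewrite exprD -scalerA -[_ *: (_ *: _)]addr0.
    by apply: sL.2 => //; apply: sL.1.
  (* The [y]-saturation of [L] is finitely generated, so a single power [y^k] carries it into
     [L]. *)
  have sLy : submod [set v | exists j, L (y ^+ j *: v)].
    split=> [|a u v [i Lu] [j Lv]]; first by exists 0%N; rewrite scaler0; apply: sL.1.
    exists (i + j)%N; rewrite scalerDr scalerA mulrC -scalerA.
    by apply: sL.2; [rewrite addnC|]; apply: LD.
  have [d [W WP]] := submod_fin_gen sLy.
  have /choice[j jP] : forall i, exists j, L (y ^+ j *: row i W).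
    by move=> i; apply/WP; exists (delta_mx 0 i); rewrite -rowE.
  pose k := (\sum_i j i)%N.
  have Lk v i : L (y ^+ i *: v) -> L (y ^+ k *: v).
    move=> Lv; have /WP[r ->] : exists i, L (y ^+ i *: v) by exists i.
    rewrite scalemxAr; apply: submod_mulmx => // l.
    by rewrite linearZ /= /k (bigD1 l) //= addnC; apply: LD.
  (* The submodule [L + y^k R^n] has the same trace: if [r V = l + y^k v], then [y^N r V] is in
     [L0], so [y^(N+k) v] is in [L], hence so are [y^k v] and [r V]. Maximality concludes. *)
  exists k => v0; apply: (maxL [set u | exists l v, L l /\ u = l + y ^+ k *: v]).
  + split.
    * split=> [|a _ _ [l [v [Ll ->]]] [l' [v' [Ll' ->]]]].
        by exists 0, 0; split; [exact: sL.1|rewrite scaler0 addr0].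
      exists (a *: l + l'), (a *: v + v'); split; first exact: sL.2.
      by rewrite !scalerDr !scalerA mulrC addrACA.
    * by move=> u /L0L Lu; exists u, 0; rewrite scaler0 addr0.
    * move=> r [l [v [Ll rV]]]; apply: LV; rewrite rV -[l]scale1r; apply: sL.2 => //.
      apply: (Lk _ (N + k)%N); rewrite exprD -scalerA.
      have -> : y ^+ k *: v = r *m V - l by rewrite rV addrC addKr.
      rewrite scalerBr addrC -scaleNr; apply: sL.2 => //; apply: L0L.
      exists (y ^+ N *: r); last by rewrite scalemxAl.
      by apply: mxinZl => //; apply: ideal_exp_pow.
  + by move=> l Ll; exists l, 0; rewrite scaler0 addr0.
  + by exists 0, v0; split; [exact: sL.1|rewrite add0r].
pose a := [set b : R | forall v, L (b *: v)].
have ida : ideal a.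
  split=> [v|b u w au aw v]; first by rewrite scale0r; apply: sL.1.
  by rewrite scalerDl -scalerA; apply: sL.2.
have [s ms] := noethR idm.
have [y ys|k ka] := @ideal_exp_sub_of_pow _ s _ ida.
  by have [|k yk] := Lpow y; [rewrite ms; apply: sub_ideal_span|exists k].
exists k; rewrite ms => r rV; have [|r' r'm <-] := LV r; last by exists r'; rewrite -?ms.
rewrite [r *m V]row_sum_delta; apply: big_ind => [|u v Lu Lv|i _]; first exact: sL.1.
  by rewrite -[u]scale1r; apply: sL.2.
exact/ka/rV.
Qed.

End Noetherian.

(** * Free modules of rows and minimal free resolutions *)

Section RowMorphism.
Variables (R : comNzRingType) (V : lmodType R) (n : nat) (e : 'I_n -> V).

Definition row_morph (u : 'rV[R]_n) : V := \sum_j u 0 j *: e j.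

Lemma row_morph_linear : linear row_morph.
Proof.
move=> a u v; rewrite scaler_sumr -big_split; apply: eq_bigr => j _ /=.
by rewrite !mxE scalerDl scalerA.
Qed.

HB.instance Definition _ :=
  GRing.isLinear.Build R 'rV[R]_n V *:%R row_morph row_morph_linear.

End RowMorphism.

Lemma linear_rowE (R : comNzRingType) (V : lmodType R) n
  (g : {linear 'rV[R]_n -> V}) u : g u = \sum_j u 0 j *: g (delta_mx 0 j).
Proof.
by rewrite {1}[u]row_sum_delta linear_sum; apply: eq_bigr => j _; rewrite linearZ.
Qed.

Lemma projective_row (R : comNzRingType) n : projective ('rV[R]_n : lmodType R).
Proof.
move=> V W g f g_surj; have [h hK] := choice g_surj.
exists (row_morph (fun j => h (f (delta_mx 0 j)))) => u.
by rewrite linear_sum [RHS]linear_rowE; apply: eq_bigr => j _; rewrite linearZ /= hK.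
Qed.

Section MinimalGenerators.
Variable R : comNzRingType.

(** The count concerns the image of [e], not [V], so that differentials as well as augmentations can
    be minimal. *)
Definition min_gens (V : lmodType R) n (e : {linear 'rV[R]_n -> V}) :=
  forall n' (e' : {linear 'rV[R]_n' -> V}),
    (forall v, (exists u, v = e u) <-> (exists u, v = e' u)) -> (n <= n')%N.

Hypothesis noethR : noetherian R.
Variable m : set R.
Hypothesis m_units : forall a, ~ m a -> exists b, b * a = 1.

(** A unit coefficient in a relation would make one generator redundant. *)
Lemma min_gens_relation (V : lmodType R) n (e : {linear 'rV[R]_n -> V}) (u : 'rV_n) :
  min_gens e -> e u = 0 -> mxin m u.
Proof.
move=> min_e eu i j; rewrite ord1; apply: contrapT => /m_units[b bu].
case: n => [|n] in e u min_e eu j bu *; first by case: (j).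
suff : (n.+1 <= n)%N by rewrite ltnn.
pose e' : {linear 'rV_n -> V} := row_morph (fun k => e (delta_mx 0 (fintype.lift j k))).
apply: (min_e n e') => v; split.
  move=> [w ->]; pose w' := w - (w 0 j * b) *: u.
  have w'j : w' 0 j = 0 by rewrite !mxE -mulrA bu mulr1 subrr.
  have -> : e w = e w' by rewrite linearB linearZ /= eu scaler0 subr0.
  exists (\row_k w' 0 (fintype.lift j k)); rewrite linear_rowE /row_morph.
  rewrite (bigD1_ord j) //= w'j scale0r add0r.
  by apply: eq_bigr => k _; rewrite mxE.
move=> [w ->]; exists (\sum_k w 0 k *: delta_mx 0 (fintype.lift j k)).
by rewrite linear_sum; apply: eq_bigr => k _; rewrite linearZ.
Qed.

Lemma min_syzygy (V : lmodType R) n (e : {linear 'rV[R]_n -> V}) :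
  exists c (D : 'M[R]_(c, n)),
    (forall u, e u = 0 <-> exists r, u = r *m D) /\
    min_gens (mulmxr D : {linear 'rV_c -> 'rV_n}).
Proof.
pose P c := `[< exists D : 'M[R]_(c, n), forall u, e u = 0 <-> exists r, u = r *m D >].
have exP : exists c, P c.
  have [|c [D DP]] := submod_fin_gen noethR (K := [set u | e u = 0]); last first.
    by exists c; apply/asboolP; exists D.
  split=> [|a u v /= eu ev]; rewrite /= ?linear0 //.
  by rewrite linearD linearZ /= eu ev scaler0 addr0.
case: (ex_minnP exP) => c /asboolP[D DP] min_c; exists c, D; split=> // c' e' e'P.
apply: min_c; apply/asboolP; exists (lin1_mx e') => u; rewrite DP.
split=> [/e'P[r ->]|[r ->]]; first by exists r; rewrite mul_rV_lin1.
by apply/e'P; exists r; rewrite mul_rV_lin1.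
Qed.

Lemma min_cover (V : lmodType R) : fin_gen V ->
  exists n (e : {linear 'rV[R]_n -> V}), (forall v, exists u, e u = v) /\ min_gens e.
Proof.
move=> [k [g gP]].
pose P n := `[< exists e : {linear 'rV[R]_n -> V}, forall v, exists u, e u = v >].
have exP : exists n, P n.
  exists k; apply/asboolP; exists (row_morph g) => v; have [c ->] := gP v.
  by exists (\row_i c i); apply: eq_bigr => i _; rewrite mxE.
case: (ex_minnP exP) => n /asboolP[e eP] min_n; exists n, e; split=> // n' e' e'P.
apply: min_n; apply/asboolP; exists e' => v.
by have [u uv] := eP v; have [|w] := (e'P v).1; [exists u|exists w].
Qed.

Record min_resolution (V : lmodType R) := MinResolution {
  mr_rank : nat -> nat;
  mr_diff : forall i, 'M[R]_(mr_rank i.+1, mr_rank i);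
  mr_aug : {linear 'rV[R]_(mr_rank 0) -> V};
  mr_aug_surj : forall v, exists u, mr_aug u = v;
  mr_aug_exact : forall u, mr_aug u = 0 <-> exists r, u = r *m mr_diff 0;
  mr_diff2 : forall i, mr_diff i.+1 *m mr_diff i = 0;
  mr_exact : forall i, exact (mr_diff i) (mr_diff i.+1);
  mr_min : forall i, mxin m (mr_diff i)
}.

(** Bundling the ranks with the differential reduces the dependent recursion to [iter]. Minimality
    is carried along because it forces the next differential to have entries in [m]. *)
Record stage := Stage {
  stage_src : nat; stage_tgt : nat;
  stage_diff : 'M[R]_(stage_src, stage_tgt);
  stage_min : min_gens (mulmxr stage_diff : {linear 'rV_stage_src -> 'rV_stage_tgt}) }.

Lemma min_resolution_exists (V : lmodType R) : fin_gen V -> inhabited (min_resolution V).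
Proof.
move=> /min_cover[n [e [e_surj e_min]]].
have [c [D0 [eD0 D0_min]]] := min_syzygy e.
have exnext (S : stage) : exists T : {c & 'M[R]_(c, stage_src S)},
    (forall u : 'rV_(stage_src S),
       u *m stage_diff S = 0 <-> exists r, u = r *m tagged T) /\
    min_gens (mulmxr (tagged T) : {linear 'rV_(tag T) -> 'rV_(stage_src S)}).
  have [k [D DP]] := min_syzygy
    (mulmxr (stage_diff S) : {linear 'rV_(stage_src S) -> 'rV_(stage_tgt S)}).
  by exists (Tagged (fun k => 'M[R]_(k, stage_src S)) D).
pose next S := projT1 (cid (exnext S)); have nextP S := projT2 (cid (exnext S)).
pose step S := @Stage _ (stage_src S) (tagged (next S)) (nextP S).2.
pose S i := iter i step (Stage D0_min).
have S_exact i (u : 'rV_(stage_src (S i))) :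
    u *m stage_diff (S i) = 0 <-> exists r, u = r *m stage_diff (S i.+1).
  exact: (nextP (S i)).1.
constructor; apply: (@MinResolution V
  (fun i => stage_tgt (S i)) (fun i => stage_diff (S i)) e).
- exact: e_surj.
- exact: eD0.
- move=> i; apply/row_matrixP => k; rewrite row0 row_mul.
  by apply/S_exact; exists (delta_mx 0 k); rewrite -rowE.
- move=> i q X X0.
  have /choice[r rP] : forall k, exists r, row k X = r *m stage_diff (S i.+1).
    by move=> k; apply/S_exact; rewrite -row_mul X0 row0.
  by exists (\matrix_k r k); apply/row_matrixP => k; rewrite row_mul rowK rP.
- case=> [|i] k l.
    have := @min_gens_relation _ _ e (row k D0) e_min; rewrite /mxin => /(_ _ 0 l).
    by rewrite mxE; apply; apply/eD0; exists (delta_mx 0 k); rewrite -rowE.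
  have := @min_gens_relation _ _ _ (row k (stage_diff (S i.+1))) (@stage_min (S i)).
  rewrite /mxin => /(_ _ 0 l); rewrite mxE; apply.
  by apply/S_exact; exists (delta_mx 0 k); rewrite -rowE.
Qed.

Section FreeResolution.
Variables (V : lmodType R) (F : min_resolution V).

Definition mr_proj_resolution : proj_resolution V.
Proof.
apply: (@ProjResolution R V (fun i => 'rV[R]_(mr_rank F i))
  (fun i => mulmxr (mr_diff F i)) (mr_aug F)).
- by move=> i; apply: projective_row.
- exact: mr_aug_surj.
- by move=> u; rewrite mr_aug_exact; split=> -[r rE]; exists r.
- move=> i u /=; split=> [/(@mr_exact _ F i)[r ->]|[r <-]]; first by exists r.
  by rewrite /= -mulmxA mr_diff2 mulmx0.
Defined.

Hypotheses (idm : ideal m) (m1 : ~ m 1).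

(** If [C = 0], exactness factors the identity through [C'], which would put 1 in [m]. *)
Lemma mr_rank_eq0 a b c (C : 'M[R]_(b, a)) (C' : 'M_(c, b)) :
  exact C C' -> mxin m C' -> C = 0 -> b = 0%N.
Proof.
move=> ex mC' C0; have [//|b_gt0] := posnP b; exfalso; apply: m1.
have [|Y YE] := ex _ 1%:M; first by rewrite C0 mulmx0.
pose i := Ordinal b_gt0; have /matrixP/(_ i i) := YE; rewrite mxE eqxx mulr1n => ->.
exact: mxinMl.
Qed.

Lemma finite_proj_dim_of_rank i : mr_rank F i = 0%N -> finite_proj_dim V.
Proof.
move=> ri; exists mr_proj_resolution, i => j lt_ij.
have rj : mr_rank F j = 0%N.
  rewrite -(subnK (ltnW lt_ij)); elim: (j - i)%N => [//|d rd]; rewrite addSn.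
  apply: (mr_rank_eq0 (@mr_exact _ F (d + i)) (@mr_min _ F _)).
  by move: (mr_diff F (d + i)); rewrite rd => D; apply: thinmx0.
by change (forall p : 'rV[R]_(mr_rank F j), p = 0); rewrite rj => p; apply: thinmx0.
Qed.

End FreeResolution.
End MinimalGenerators.

(** * Comparison and homotopy of projective resolutions *)

Section LinearImage.
Variables (R : comNzRingType) (V W : lmodType R) (g : {linear V -> W}).

Definition linear_image : {pred W} := fun w => `[< exists v, g v = w >].

Lemma linear_image_submod : submod_closed linear_image.
Proof.
split=> [|a _ _ /asboolP[v <-] /asboolP[v' <-]].
  by apply/asboolP; exists 0; rewrite linear0.
by apply/asboolP; exists (a *: v + v'); rewrite linearP.
Qed.

HB.instance Definition _ :=
  GRing.isSubmodClosed.Build R W linear_image linear_image_submod.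

Record image_type := ImageType { image_val : W; _ : image_val \in linear_image }.

HB.instance Definition _ := [isSub for image_val].
HB.instance Definition _ := [Choice of image_type by <:].
HB.instance Definition _ := [SubChoice_isSubLmodule of image_type by <:].

End LinearImage.

(** Projectivity speaks of surjections only; corestricting [g] to its image makes it one. *)
Lemma projective_lift (R : comNzRingType) (P V W : lmodType R)
    (g : {linear V -> W}) (f : {linear P -> W}) : projective P ->
  (forall p, exists v, g v = f p) -> exists h : {linear P -> V}, forall p, g (h p) = f p.
Proof.
move=> projP fg.
have gim v : g v \in linear_image g by apply/asboolP; exists v.
have fim p : f p \in linear_image g by apply/asboolP; exact: fg.
pose g' v : image_type g := ImageType (gim v).
pose f' p : image_type g := ImageType (fim p).
have g'l : linear g' by move=> a u v; apply/val_inj; rewrite /= linearP.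
have f'l : linear f' by move=> a u v; apply/val_inj; rewrite /= linearP.
pose G : {linear V -> image_type g} :=
  HB.pack g' (GRing.isLinear.Build _ _ _ _ g' g'l).
pose F : {linear P -> image_type g} :=
  HB.pack f' (GRing.isLinear.Build _ _ _ _ f' f'l).
have [|h hK] := projP _ _ G F.
  by case=> w wi; have /asboolP[v vw] := wi; exists v; apply/val_inj.
by exists h => p; have /(congr1 val) := hK p.
Qed.

Section Comparison.
Variables (R : comNzRingType) (V : lmodType R).

Lemma res_diff2 (P : proj_resolution V) i (p : P i.+2) :
  res_diff P i (res_diff P i.+1 p) = 0.
Proof. by apply/res_exact; exists p. Qed.

Lemma comparison (P Q : proj_resolution V) :
  exists phi : forall i, {linear P i -> Q i},
    (forall p, res_aug Q (phi 0%N p) = res_aug P p) /\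
    forall i p, res_diff Q i (phi i.+1 p) = phi i (res_diff P i p).
Proof.
(* The invariant says that [f] can be continued one degree up; the recursion carries it together
   with [f]. *)
pose ok i (f : {linear P i -> Q i}) :=
  forall p, exists q, res_diff Q i q = f (res_diff P i p).
have [phi0 phi0P] : exists f : {linear P 0%N -> Q 0%N},
    forall p, res_aug Q (f p) = res_aug P p.
  by apply: projective_lift => [|p]; [exact: res_projective|exact: res_aug_surj].
have ok0 : ok 0%N phi0.
  by move=> p; apply/res_aug_exact; rewrite phi0P; apply/res_aug_exact; exists p.
have exS i (f : {f | ok i f}) : exists f' : {f' | ok i.+1 f'},
    forall p, res_diff Q i (sval f' p) = sval f (res_diff P i p).
  case: f => f fP /=.
  have [|p|f' f'P] := @projective_lift _ _ _ _ (res_diff Q i) (f \o res_diff P i).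
  - exact: res_projective.
  - exact: fP.
  suff f'ok : ok i.+1 f' by exists (exist _ f' f'ok).
  by move=> p; apply/res_exact; rewrite f'P /= res_diff2 linear0.
pose phi := nat_rect (fun i => {f | ok i f}) (exist _ phi0 ok0)
  (fun i f => sval (cid (exS i f))).
exists (fun i => sval (phi i)); split=> [|i p]; first exact: phi0P.
exact: (svalP (cid (exS i (phi i)))).
Qed.

(** Since [chi] lifts the zero map of [V], each [chi - h d] takes values in cycles and lifts through
    the next differential. The invariant [ok] records exactly this. *)
Lemma homotopy (Q : proj_resolution V) (chi : forall i, {linear Q i -> Q i}) :
  (forall q, res_aug Q (chi 0%N q) = 0) ->
  (forall i q, res_diff Q i (chi i.+1 q) = chi i (res_diff Q i q)) ->
  exists h : forall i, {linear Q i -> Q i.+1}, forall i q,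
    chi i.+1 q = res_diff Q i.+1 (h i.+1 q) + h i (res_diff Q i q).
Proof.
move=> chi0 chiS.
pose ok i (f : {linear Q i -> Q i.+1}) :=
  forall q, res_diff Q i (f (res_diff Q i q)) = chi i (res_diff Q i q).
have [h0 h0P] : exists f : {linear Q 0%N -> Q 1%N},
    forall q, res_diff Q 0 (f q) = chi 0%N q.
  by apply: projective_lift => [|q]; [exact: res_projective|exact/res_aug_exact].
have ok0 : ok 0%N h0 by move=> q; apply: h0P.
have exS i (f : {f | ok i f}) : exists f' : {f' | ok i.+1 f'}, forall q,
    chi i.+1 q = res_diff Q i.+1 (sval f' q) + sval f (res_diff Q i q).
  case: f => f fP /=.
  have [|q|f' f'P] := @projective_lift _ _ _ _ (res_diff Q i.+1)
      (chi i.+1 \- (f \o res_diff Q i)).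
  - exact: res_projective.
  - by apply/res_exact; rewrite /= linearB chiS /= fP subrr.
  suff f'ok : ok i.+1 f'.
    by exists (exist _ f' f'ok) => q; rewrite /= f'P /= subrK.
  by move=> q; rewrite f'P /= res_diff2 linear0 subr0.
pose h := nat_rect (fun i => {f | ok i f}) (exist _ h0 ok0)
  (fun i f => sval (cid (exS i f))).
exists (fun i => sval (h i)) => i q.
exact: (svalP (cid (exS i (h i)))).
Qed.

End Comparison.

(** * Tensor products and maps out of them *)

Section TensorTheory.
Variables (R : comNzRingType) (M N : lmodType R).

Definition pure_tensor (x : M) (y : N) : tensor M N := tensor_pi << (x, y) >>.

Lemma tensor_piB z w : tensor_pi (z - w) = tensor_pi z - tensor_pi w :> tensor M N.
Proof. exact: raddfB. Qed.

Lemma tensor_pi_eq0 (z : {freeg (M * N)%type / int}) :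
  tensor_pi z = 0 :> tensor M N <->
    smallest (@additive_subgroup _ M N) (@bilinear_rel _ M N) z.
Proof.
rewrite -(raddf0 (\pi_(Quotient.quot (@tensor_ker _ M N))%qT)).
split=> [/eqP|z0]; first by rewrite -Quotient.idealrBE subr0 => /asboolP.
by apply/eqP; rewrite -Quotient.idealrBE subr0; apply/asboolP.
Qed.

Lemma bilinear_rel_eq0 z : bilinear_rel z -> tensor_pi z = 0 :> tensor M N.
Proof. by move=> rz; apply/tensor_pi_eq0 => A [_]; apply. Qed.

Lemma pure_tensorDl x x' y :
  pure_tensor (x + x') y = pure_tensor x y + pure_tensor x' y.
Proof.
apply/eqP; rewrite -subr_eq0 opprD addrA -!tensor_piB.
by apply/eqP/bilinear_rel_eq0; constructor 1; exists x, x', y.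
Qed.

Lemma pure_tensorDr x y y' :
  pure_tensor x (y + y') = pure_tensor x y + pure_tensor x y'.
Proof.
apply/eqP; rewrite -subr_eq0 opprD addrA -!tensor_piB.
by apply/eqP/bilinear_rel_eq0; constructor 2; exists x, y, y'.
Qed.

Lemma pure_tensorZ a x y : pure_tensor (a *: x) y = pure_tensor x (a *: y).
Proof.
apply/eqP; rewrite -subr_eq0 -!tensor_piB.
by apply/eqP/bilinear_rel_eq0; constructor 3; exists a, x, y.
Qed.

Lemma pure_tensor0r x : pure_tensor x 0 = 0.
Proof. by apply: (addrI (pure_tensor x 0)); rewrite -pure_tensorDr !addr0. Qed.

Lemma pure_tensor0l y : pure_tensor 0 y = 0.
Proof. by apply: (addrI (pure_tensor 0 y)); rewrite -pure_tensorDl !addr0. Qed.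

Lemma pure_tensor_suml (I : finType) (F : I -> M) y :
  pure_tensor (\sum_i F i) y = \sum_i pure_tensor (F i) y.
Proof.
exact: (big_morph (fun x => pure_tensor x y)
  (fun x x' => pure_tensorDl x x' y) (pure_tensor0l y)).
Qed.

Lemma pure_tensor_sumr (I : finType) x (F : I -> N) :
  pure_tensor x (\sum_i F i) = \sum_i pure_tensor x (F i).
Proof. exact: (big_morph _ (pure_tensorDr x) (pure_tensor0r x)). Qed.

Lemma freeg_generated (K : choiceType) (P : {freeg K / int} -> Prop) :
  P 0 -> (forall z w, P z -> P w -> P (z - w)) -> (forall x, P << x >>) -> forall z, P z.
Proof.
move=> P0 PB PU z.
have PN w : P w -> P (- w) by move=> Pw; rewrite -sub0r; apply: PB.
have PD w w' : P w -> P w' -> P (w + w').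
  by move=> Pw /PN Pw'; rewrite -[w']opprK; apply: PB.
rewrite -(freeg_sumE z); apply: big_ind => // x _.
have Pn n : P << n%:Z *g x >>.
  elim: n => [|n IHn]; first by rewrite freegU0.
  by rewrite -addn1 PoszD -freegUD; apply: PD.
case: (coeff x z) => n; first exact: Pn.
by rewrite NegzE -freegUN; apply: PN.
Qed.

Lemma tensor_generated (P : tensor M N -> Prop) :
  P 0 -> (forall z w, P z -> P w -> P (z - w)) -> (forall x y, P (pure_tensor x y)) ->
  forall z, P z.
Proof.
move=> P0 PB PU z; have -> : z = tensor_pi (tensor_repr z) by rewrite /tensor_pi reprK.
apply: (freeg_generated (P := fun w => P (tensor_pi w))).
- by rewrite /tensor_pi raddf0.
- by move=> w w' Pw Pw'; rewrite tensor_piB; apply: PB.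
- by case=> x y; apply: PU.
Qed.

Lemma tensor_reprP z : smallest (@additive_subgroup _ M N) (@bilinear_rel _ M N)
  (tensor_repr (tensor_pi z) - z).
Proof. by apply/tensor_pi_eq0; rewrite tensor_piB {1}/tensor_pi reprK subrr. Qed.

(** Maps out of the tensor product are defined on chosen representatives; bilinearity makes the
    choice harmless. [p] is the projection onto the target, [tensor_pi] or the identity. *)
Lemma fglift_ker (V : zmodType) (W : lmodType int) (g : M * N -> W) (p : W -> V) :
  p 0 = 0 -> (forall a b, p (a - b) = p a - p b) ->
  (forall x x' y, p (g (x + x', y)) = p (g (x, y)) + p (g (x', y))) ->
  (forall x y y', p (g (x, y + y')) = p (g (x, y)) + p (g (x, y'))) ->
  (forall a x y, p (g (a *: x, y)) = p (g (x, a *: y))) ->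
  forall z, p (fglift g (tensor_repr (tensor_pi z))) = p (fglift g z).
Proof.
move=> p0 pB gDl gDr gZ z; apply/eqP; rewrite -subr_eq0 -pB -(lift_is_additive g).
apply/eqP; have := tensor_reprP z.
apply: (_ : smallest _ _ `<=` [set w | p (fglift g w) = 0]); apply: smallest_sub.
  split=> [|w w' /= pw pw'].
    by rewrite /= -(subrr (0 : {freeg (M * N)%type / int})) lift_is_additive subrr.
  by rewrite lift_is_additive pB pw pw' subrr.
move=> _ [[x [x' [y ->]]]|[x [y [y' ->]]]|[a [x [y ->]]]] /=;
  rewrite !lift_is_additive !liftU !scale1r !pB ?(gDl, gDr, gZ) ?subrr //.
- by rewrite addrAC addrK subrr.
- by rewrite addrAC addrK subrr.
Qed.

End TensorTheory.

Section TensorMaps.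
Variables (R : comNzRingType) (M N : lmodType R).

Section Map.
Variables (M' : lmodType R) (f : {linear M -> M'}).

Lemma tensor_map_pi z : tensor_map (N := N) f (tensor_pi z) =
  tensor_pi (fglift (fun xy => << (f xy.1, xy.2) >>) z).
Proof.
apply: (fglift_ker (p := fun w => tensor_pi w : tensor M' N)) => /=.
- by rewrite /tensor_pi raddf0.
- exact: tensor_piB.
- by move=> x x' y; rewrite linearD; apply: pure_tensorDl.
- by move=> x y y'; apply: pure_tensorDr.
- by move=> a x y; rewrite linearZ; apply: pure_tensorZ.
Qed.

Lemma tensor_map_pure x y :
  tensor_map f (pure_tensor x y : tensor M N) = pure_tensor (f x) y.
Proof. by rewrite tensor_map_pi liftU scale1r. Qed.

Lemma tensor_mapB : {morph tensor_map (N := N) f : z w / z - w}.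
Proof.
move=> z w.
have piK u : u = tensor_pi (tensor_repr u) :> tensor M N by rewrite /tensor_pi reprK.
by rewrite [z]piK [w]piK -tensor_piB !tensor_map_pi lift_is_additive tensor_piB.
Qed.

Lemma tensor_map0 : tensor_map (N := N) f 0 = 0.
Proof. by rewrite -(subrr 0) tensor_mapB subrr. Qed.

Lemma tensor_mapD : {morph tensor_map (N := N) f : z w / z + w}.
Proof.
by move=> z w; rewrite -[w in LHS]opprK -(sub0r w) !tensor_mapB tensor_map0 sub0r opprK.
Qed.

Lemma tensor_map_sum (I : finType) (F : I -> tensor M N) :
  tensor_map f (\sum_i F i) = \sum_i tensor_map f (F i).
Proof. exact: (big_morph _ tensor_mapD tensor_map0). Qed.

End Map.

Section Contraction.
Variable (phi : {linear M -> R^o}).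

(** This is [phi (x) N] followed by the identification of [R (x) N] with [N]; [zmodule N] is [N] as
    a module over the integers, as [fglift] requires. *)
Definition contract (z : tensor M N) : N :=
  fglift (fun xy => phi xy.1 *: xy.2 : zmodule N) (tensor_repr z).

Lemma contract_pi z :
  contract (tensor_pi z) = fglift (fun xy => phi xy.1 *: xy.2 : zmodule N) z.
Proof.
apply: (fglift_ker (p := fun w : zmodule N => w : N)) => //=.
- by move=> x x' y; rewrite linearD scalerDl.
- by move=> x y y'; rewrite scalerDr.
- by move=> a x y; rewrite linearZ /= scalerA mulrC.
Qed.

Lemma contract_pure x y : contract (pure_tensor x y) = phi x *: y.
Proof. by rewrite contract_pi liftU scale1r. Qed.

Lemma contractB : {morph contract : z w / z - w}.
Proof.
move=> z w.
have piK u : u = tensor_pi (tensor_repr u) :> tensor M N by rewrite /tensor_pi reprK.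
by rewrite [z]piK [w]piK -tensor_piB !contract_pi lift_is_additive.
Qed.

Lemma contract0 : contract 0 = 0.
Proof. by rewrite -(subrr 0) contractB subrr. Qed.

Lemma contractD : {morph contract : z w / z + w}.
Proof.
by move=> z w; rewrite -[w in LHS]opprK -(sub0r w) !contractB contract0 sub0r opprK.
Qed.

Lemma contract_sum (I : finType) (F : I -> tensor M N) :
  contract (\sum_i F i) = \sum_i contract (F i).
Proof. exact: (big_morph _ contractD contract0). Qed.

End Contraction.
End TensorMaps.

(** * Tor computed from minimal resolutions *)

Section TorOfMinimalResolution.
Variables (R : comNzRingType) (m : set R) (M N : lmodType R).
Variable F : min_resolution m M.

Definition coord_row n (b : 'I_n) (u : 'rV[R]_n) : R^o := u 0 b.

Lemma coord_row_linear n (b : 'I_n) : linear (coord_row b).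
Proof. by move=> a u v; rewrite /coord_row !mxE. Qed.

HB.instance Definition _ n (b : 'I_n) :=
  GRing.isLinear.Build R 'rV[R]_n R^o *:%R (coord_row b) (coord_row_linear b).

(** A family [v] stands for the sum of the [e_a (x) v_a]. The cycle is pushed by [phi] to the
    resolution [P] that witnesses [Tor_eq0], bounded there, and brought back by [psi]. In the
    homotopy from [psi phi] to the identity, the term [h d] vanishes on the cycle and the term [d h]
    is absorbed in the witness. *)
Lemma Tor_eq0_min_resolution i (v : 'I_(mr_rank F i.+1) -> N) :
  Tor_eq0 M N i.+1 -> (forall b, \sum_a mr_diff F i a b *: v a = 0) ->
  exists w : 'I_(mr_rank F i.+2) -> N,
    forall b, v b = \sum_a mr_diff F i.+1 a b *: w a.
Proof.
move=> [P /= exP] dv.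
pose Q := mr_proj_resolution F.
have [phi [phi0 phiS]] := comparison Q P.
have [psi [psi0 psiS]] := comparison P Q.
have [||h hE] := @homotopy _ _ Q (fun i => (psi i \o phi i) \- idfun).
- by move=> q; rewrite /= linearB psi0 phi0 subrr.
- move=> j q; change (res_diff Q j (psi j.+1 (phi j.+1 q) - q) =
    psi j (phi j (res_diff Q j q)) - res_diff Q j q).
  by rewrite linearB psiS phiS.
pose e k : 'I_(mr_rank F k) -> Q k := fun a => delta_mx 0 a.
have dQ k a : res_diff Q k (e k.+1 a) = \sum_b mr_diff F k a b *: e k b.
  by rewrite /= -rowE [LHS]row_sum_delta; apply: eq_bigr => b _; rewrite mxE.
pose z : tensor (P i.+1) N := \sum_a pure_tensor (phi i.+1 (e i.+1 a)) (v a).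
have [|w wz] := exP z.
  rewrite tensor_map_sum; under eq_bigr => a _.
    rewrite tensor_map_pure phiS dQ linear_sum pure_tensor_suml.
    under eq_bigr => b _ do rewrite linearZ /= pure_tensorZ.
    over.
  rewrite exchange_big big1 //= => b _.
  by rewrite -pure_tensor_sumr dv pure_tensor0r.
pose y c := contract (coord_row c \o psi i.+2) w.
exists (fun c => y c - \sum_a coord_row c (h i.+1 (e i.+1 a)) *: v a) => b.
have zE : \sum_a coord_row b (psi i.+1 (phi i.+1 (e i.+1 a))) *: v a =
    \sum_c mr_diff F i.+1 c b *: y c.
  transitivity (contract (coord_row b \o psi i.+1) z).
    by rewrite contract_sum; apply: eq_bigr => a _; rewrite contract_pure.
  rewrite -wz /y; elim/tensor_generated: w {wz y} => [|w w' IH IH'|p u].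
  - rewrite tensor_map0 contract0 big1 // => c _; by rewrite contract0 scaler0.
  - rewrite tensor_mapB contractB IH IH' -sumrB; apply: eq_bigr => c _.
    by rewrite contractB scalerBr.
  - rewrite tensor_map_pure contract_pure /= -psiS /= /coord_row mxE scaler_suml.
    by apply: eq_bigr => c _; rewrite contract_pure scalerA mulrC.
have psiphi a : psi i.+1 (phi i.+1 (e i.+1 a)) =
    e i.+1 a + res_diff Q i.+1 (h i.+1 (e i.+1 a)) + h i (res_diff Q i (e i.+1 a)).
  by rewrite -addrA -hE /= addrC subrK.
have cZ c (u : 'rV[R]_(mr_rank F i.+1)) (x : N) :
    coord_row b (c *: u) *: x = coord_row b u *: (c *: x).
  by rewrite /coord_row mxE mulrC scalerA.
have hd0 : \sum_a coord_row b (h i (res_diff Q i (e i.+1 a))) *: v a = 0.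
  under eq_bigr => a _.
    rewrite dQ !linear_sum scaler_suml.
    under eq_bigr => k _ do rewrite linearZ /= cZ.
    over.
  by rewrite exchange_big big1 //= => k _; rewrite -scaler_sumr dv scaler0.
have ve : \sum_a coord_row b (e i.+1 a) *: v a = v b.
  rewrite (bigD1 b) //= /coord_row mxE !eqxx scale1r big1 ?addr0 // => a /negPf ab.
  by rewrite mxE eq_sym ab andbF scale0r.
have := zE; have -> : \sum_a coord_row b (psi i.+1 (phi i.+1 (e i.+1 a))) *: v a =
    v b + \sum_a coord_row b (res_diff Q i.+1 (h i.+1 (e i.+1 a))) *: v a.
  rewrite -[RHS]addr0 -[X in _ = _ + X]hd0 -[X in _ = X + _ + _]ve -!big_split.
  apply: eq_bigr => a _ /=.
  by rewrite psiphi /coord_row !mxE !scalerDl.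
move=> /(canRL (addrK _)) ->.
under [RHS]eq_bigr => c _ do rewrite scalerBr.
rewrite sumrB; congr (_ - _); under [RHS]eq_bigr => c _ do rewrite scaler_sumr.
rewrite exchange_big; apply: eq_bigr => a _ /=; rewrite /coord_row mxE scaler_suml.
by apply: eq_bigr => c _; rewrite scalerA mulrC.
Qed.

End TorOfMinimalResolution.

Section TorVanishes.
Variables (R : comNzRingType) (m : set R) (M N : lmodType R).
Variables (F : min_resolution m M) (G : min_resolution m N).

(** Lifting along the augmentation of [G] replaces elements of [N] by rows modulo the rows of
    [mr_diff G 0]. The matrix [mr_diff F i] starts at degree [i.+1], hence the index. *)
Lemma Tor_eq0_tor_vanishes i : Tor_eq0 M N i.+1 ->
  tor_vanishes (mr_diff F i) (mr_diff F i.+1) (mr_diff G 0).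
Proof.
move=> tor0 X Y XY.
have dX b : \sum_a mr_diff F i a b *: mr_aug G (row a X) = 0.
  transitivity (mr_aug G (row b ((mr_diff F i)^T *m X))).
    rewrite row_mul mulmx_sum_row linear_sum; apply: eq_bigr => a _.
    by rewrite linearZ !mxE.
  by rewrite XY; apply/mr_aug_exact; exists (row b Y); rewrite row_mul.
have [w wE] := Tor_eq0_min_resolution tor0 dX.
have /choice[u uE] : forall a, exists u, mr_aug G u = w a.
  by move=> a; apply: mr_aug_surj.
pose U := \matrix_a u a.
have XU b : exists r, row b (X - (mr_diff F i.+1)^T *m U) = r *m mr_diff G 0.
  apply/mr_aug_exact; rewrite linearB /= linearB /= wE row_mul mulmx_sum_row linear_sum.
  rewrite -sumrB big1 // => a _.
  by rewrite linearZ !mxE /= rowK uE subrr.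
have [V VE] := choice XU.
exists U, (\matrix_b V b); apply/row_matrixP => b.
rewrite linearD /= [row b (_ *m mr_diff G 0)]row_mul rowK -VE linearB /=.
by rewrite addrC subrK.
Qed.

End TorVanishes.

(** * Flat base change *)

Lemma exact_of_rows (A : comNzRingType) a b c (C : 'M[A]_(b, a)) (C' : 'M_(c, b)) :
  (forall u : 'rV_b, u *m C = 0 -> exists r, u = r *m C') -> exact C C'.
Proof.
move=> ex q X X0; have /choice[r rP] : forall k, exists r, row k X = r *m C'.
  by move=> k; apply: ex; rewrite -row_mul X0 row0.
by exists (\matrix_k r k); apply/row_matrixP => k; rewrite row_mul rowK rP.
Qed.

Section FlatMap.
Variables (R B : comNzRingType) (f : {rmorphism R -> B}).
Hypothesis noethR : noetherian R.
Hypothesis f_flat : forall a b c (C : 'M[R]_(b, a)) (C' : 'M_(c, b)),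
  C' *m C = 0 -> exact C C' -> exact (map_mx f C) (map_mx f C').

Lemma syzygy_matrix a b (C : 'M[R]_(b, a)) :
  exists c (C' : 'M_(c, b)), C' *m C = 0 /\ exact C C'.
Proof.
have [|c [V VP]] := submod_fin_gen noethR (K := [set u : 'rV_b | u *m C = 0]).
  split=> [|d u v /= u0 v0]; rewrite /= ?mul0mx //.
  by rewrite mulmxDl -scalemxAl u0 v0 scaler0 addr0.
exists c, V; split; last by apply: exact_of_rows => u /VP.
apply/row_matrixP => i; rewrite row_mul row0; apply/VP.
by exists (delta_mx 0 i); rewrite -rowE.
Qed.

(* A solution over [B] of the linear system [D0^T X = Y E] is a combination    *)
(* of solutions over [R].                                                      *)
Lemma tor_vanishes_flat p0 p1 p2 q0 q1 (D0 : 'M[R]_(p1, p0))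
    (D1 : 'M_(p2, p1)) (E : 'M_(q1, q0)) : tor_vanishes D0 D1 E ->
  tor_vanishes (map_mx f D0) (map_mx f D1) (map_mx f E).
Proof.
move=> tv X Y XY.
(* [C] is the linear map [(X, Y) |-> D0^T X - Y E] on vectorised pairs; its row kernel is the
   solution module. *)
pose C := col_mx (lin_mx (mulmx D0^T)) (- lin_mx (mulmxr E)) :
  'M[R]_(p1 * q0 + p0 * q1, p0 * q0).
have CE (X' : 'M_(p1, q0)) (Y' : 'M_(p0, q1)) :
    row_mx (mxvec X') (mxvec Y') *m C = mxvec (D0^T *m X' - Y' *m E).
  by rewrite mul_row_col mulmxN !mul_vec_lin -linearB.
have [c [V [VC exV]]] := syzygy_matrix C.
have [|r rE] := f_flat VC exV (X := row_mx (mxvec X) (mxvec Y)).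
  rewrite map_col_mx map_mxN (map_lin_mx (gf := mulmx (map_mx f D0)^T)); last first.
    by move=> A; rewrite map_mxM map_trmx.
  rewrite (map_lin_mx (gf := mulmxr (map_mx f E))) => [|A]; last by rewrite /= map_mxM.
  by rewrite mul_row_col mulmxN !mul_vec_lin -linearB /= XY subrr linear0.
have /choice[U UP] : forall k, exists UV : 'M_(p2, q0) * 'M_(p1, q1),
    lsubmx (row k V) = mxvec (D1^T *m UV.1 + UV.2 *m E).
  move=> k; pose X' := vec_mx (lsubmx (row k V)) : 'M_(p1, q0).
  pose Y' := vec_mx (rsubmx (row k V)) : 'M_(p0, q1).
  have [|U [W UW]] := tv X' Y'; last by exists (U, W); rewrite /= -UW vec_mxK.
  apply/eqP; rewrite -subr_eq0 -mxvec_eq0 -CE !vec_mxK hsubmxK.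
  by rewrite -row_mul VC row0.
exists (\sum_k r 0 k *: map_mx f (U k).1), (\sum_k r 0 k *: map_mx f (U k).2).
apply: (can_inj mxvecK).
have -> : mxvec X = r *m map_mx f (lsubmx V).
  by rewrite map_lsubmx mulmx_lsub -rE row_mxKl.
rewrite mulmx_sum_row mulmx_sumr mulmx_suml -big_split linear_sum.
apply: eq_bigr => k _ /=; rewrite -scalemxAr -scalemxAl -scalerDr linearZ /=.
congr (_ *: _); rewrite map_trmx -!map_mxM -map_mxD -map_mxvec -UP.
by apply/rowP => j; rewrite !mxE.
Qed.

End FlatMap.

(** * The completion: limits of Cauchy sequences and flatness *)

Section CompletionTheory.
Variables (R : comNzRingType) (m : idealr R).
Local Notation m_exp := (ideal_exp [set` m]).
Local Notation Rhat := (completion m).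
Local Notation pi_hat := (\pi_(Rhat)%qT).

Definition tends0 (u : nat -> R) :=
  forall n, exists k, forall i, (k <= i)%N -> m_exp n (u i).

Definition cauchy (u : nat -> R) := forall n, exists k, forall i j,
  (k <= i)%N -> (k <= j)%N -> m_exp n (u i - u j).

Definition limit_of (z : Rhat) (u : nat -> R) :=
  exists cu : u \in cauchy_pred m, z = pi_hat (CauchySeq cu).

Lemma limit_of_exists z : exists u, limit_of z u.
Proof.
exists (val (repr z)); case: (repr z) (reprK z) => u cu <-.
by exists cu.
Qed.

Lemma limit_of_cauchy z u : limit_of z u -> cauchy u.
Proof. by case=> cu _; have /asboolP := cu. Qed.

Lemma cauchy_limit u : cauchy u -> exists z, limit_of z u.
Proof.
move=> cu; have cu' : u \in cauchy_pred m by apply/asboolP.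
by exists (pi_hat (CauchySeq cu')), cu'.
Qed.

Lemma limit_of_eq z u w v : limit_of z u -> limit_of w v ->
  (z = w <-> tends0 (fun n => u n - v n)).
Proof.
move=> [cu ->] [cv ->]; split=> [/eqP|uv].
  by rewrite -Quotient.idealrBE => /asboolP.
by apply/eqP; rewrite -Quotient.idealrBE; apply/asboolP.
Qed.

Lemma limit_ofD z u w v : limit_of z u -> limit_of w v ->
  limit_of (z + w) (fun n => u n + v n).
Proof.
move=> [cu ->] [cv ->]; rewrite -rmorphD.
have cuv : (fun n => u n + v n) \in cauchy_pred m := rpredD cu cv.
by exists cuv; congr (pi_hat _); apply/val_inj.
Qed.

Lemma limit_ofM z u w v : limit_of z u -> limit_of w v ->
  limit_of (z * w) (fun n => u n * v n).
Proof.
move=> [cu ->] [cv ->]; rewrite -rmorphM.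
have cuv : (fun n => u n * v n) \in cauchy_pred m := rpredM cu cv.
by exists cuv; congr (pi_hat _); apply/val_inj.
Qed.

Lemma cauchy_cst a : (fun=> a) \in cauchy_pred m.
Proof.
apply/asboolP => n; exists 0%N => i j _ _.
by rewrite subrr; apply: ideal0 (ideal_expP _ _).
Qed.

Definition to_completion (a : R) : Rhat := pi_hat (CauchySeq (cauchy_cst a)).

Lemma to_completion_zmod : zmod_morphism to_completion.
Proof.
by move=> a b; rewrite /to_completion -rmorphB; congr (pi_hat _); apply/val_inj.
Qed.

Lemma to_completion_monoid : monoid_morphism to_completion.
Proof.
split=> [|a b].
  by rewrite /to_completion -(rmorph1 pi_hat); congr (pi_hat _); apply/val_inj.
by rewrite /to_completion -rmorphM; congr (pi_hat _); apply/val_inj.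
Qed.

HB.instance Definition _ :=
  GRing.isZmodMorphism.Build R Rhat to_completion to_completion_zmod.
HB.instance Definition _ :=
  GRing.isMonoidMorphism.Build R Rhat to_completion to_completion_monoid.

Lemma limit_of_cst a : limit_of (to_completion a) (fun=> a).
Proof. by exists (cauchy_cst a). Qed.

End CompletionTheory.

Section CompletionFlat.
Variables (R : comNzRingType) (m : idealr R).
Local Notation m_exp := (ideal_exp [set` m]).
Local Notation Rhat := (completion m).
Local Notation iota := (@to_completion R m).

Lemma idealrP : ideal [set` m].
Proof.
split=> [|a x y mx my]; first exact: idealr0.
by apply: rpredD => //; apply: idealMr.
Qed.

Lemma tends0_eventually u : tends0 m u -> exists k, forall i, (k <= i)%N -> u i \in m.
Proof.
move=> /(_ 1%N)[k ku]; exists k => i ki.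
by have := ku i ki; rewrite (ideal_exp1 idealrP).
Qed.

Lemma limit_of_shift z u (phi : nat -> nat) :
  (forall n, (n <= phi n)%N) -> @limit_of R m z u -> limit_of z (fun n => u (phi n)).
Proof.
move=> le_phi zu; have cu := limit_of_cauchy zu.
have [w wu] : exists w, @limit_of R m w (fun n => u (phi n)).
  apply: cauchy_limit => n; have [k kP] := cu n; exists k => i j ki kj.
  by apply: kP; [apply: leq_trans (le_phi i)|apply: leq_trans (le_phi j)].
suff -> : z = w by [].
apply/(limit_of_eq zu wu) => n; have [k kP] := cu n; exists k => i ki.
by apply: kP => //; apply: leq_trans (le_phi i).
Qed.

Lemma cauchy_of_steps u : (forall n, m_exp n (u n.+1 - u n)) -> cauchy m u.
Proof.
move=> step n; have idn := ideal_expP [set` m] n.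
have near i : (n <= i)%N -> m_exp n (u i - u n).
  move=> /subnK <-; elim: (i - n)%N => [|d IHd]; first by rewrite subrr; apply: ideal0.
  rewrite addSn -[X in m_exp _ X](subrKA (u (d + n)%N)).
  apply: (idealD idn) => //.
  by apply: (ideal_exp_le (leq_addl d n)).
exists n => i j ni nj.
rewrite -(subrKA (u n)); apply: (idealD idn); first exact: near.
by rewrite -opprB; apply: (idealN idn); apply: near.
Qed.

Lemma uniform_bound (I : finType) (P : I -> nat -> Prop) :
  (forall i, exists k, forall n, (k <= n)%N -> P i n) ->
  exists k, forall n, (k <= n)%N -> forall i, P i n.
Proof.
move=> /choice[k kP]; exists (\sum_i k i)%N => n le_n i; apply: kP.
by apply: leq_trans le_n; rewrite (bigD1 i) //= leq_addr.
Qed.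

Lemma monotone_majorant (k : nat -> nat) : exists g : nat -> nat,
  [/\ forall n, (k n <= g n)%N, forall n, (n <= g n)%N & forall n, (g n <= g n.+1)%N].
Proof.
exists (fun n => \sum_(i < n.+1) k i + n)%N; split=> n; last 1 first.
- by rewrite [in leqRHS]big_ord_recr /= leq_add // leq_addr.
- by rewrite big_ord_recr /= -addnA addnCA leq_addr.
- exact: leq_addl.
Qed.

Definition mx_limit p q (Z : 'M[Rhat]_(p, q)) (U : nat -> 'M[R]_(p, q)) :=
  forall i j, limit_of (Z i j) (fun n => U n i j).

Lemma limit_of_ext z u v : u =1 v -> @limit_of R m z v -> limit_of z u.
Proof. by move=> /funext ->. Qed.

Lemma mx_limit_exists p q (Z : 'M[Rhat]_(p, q)) : exists U, mx_limit Z U.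
Proof.
have /choice[u uP] : forall ij, exists u, limit_of (Z ij.1 ij.2) u.
  by move=> ij; apply: limit_of_exists.
exists (fun n => \matrix_(i, j) u (i, j) n) => i j.
by apply: limit_of_ext (uP (i, j)) => n; rewrite mxE.
Qed.

Lemma limit_of_sum (I : finType) (z : I -> Rhat) (u : I -> nat -> R) :
  (forall i, limit_of (z i) (u i)) -> limit_of (\sum_i z i) (fun n => \sum_i u i n).
Proof.
move=> zu; have cst0 : @limit_of R m 0 (fun=> 0).
  by rewrite -(rmorph0 iota); apply: limit_of_cst.
elim: (index_enum I) => [|i s IHs].
  by rewrite big_nil; apply: limit_of_ext cst0 => n; rewrite big_nil.
rewrite big_cons; apply: limit_of_ext (limit_ofD (zu i) IHs) => n.
by rewrite big_cons.
Qed.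

Lemma mx_limitM p q r (Z : 'M[Rhat]_(p, q)) U (C : 'M[R]_(q, r)) :
  mx_limit Z U -> mx_limit (Z *m map_mx iota C) (fun n => U n *m C).
Proof.
move=> ZU i j; rewrite mxE.
apply: (limit_of_ext (v := fun n => \sum_k U n i k * C k j)) => [n|].
  by rewrite mxE.
apply: limit_of_sum => k; rewrite mxE.
by apply: limit_ofM => //; apply: limit_of_cst.
Qed.

Lemma mx_limit_eq p q (Z : 'M[Rhat]_(p, q)) U Z' U' :
  mx_limit Z U -> mx_limit Z' U' ->
  (Z = Z' <-> forall n, exists k, forall i, (k <= i)%N -> mxin (m_exp n) (U i - U' i)).
Proof.
move=> ZU ZU'; split=> [ZZ' n|UU'].
  have [|k kP] := @uniform_bound _
      (fun (ij : 'I_p * 'I_q) i => m_exp n (U i ij.1 ij.2 - U' i ij.1 ij.2)).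
    move=> [a b] /=; have := (limit_of_eq (ZU a b) (ZU' a b)).1.
    by rewrite ZZ'; apply.
  by exists k => i ki a b; rewrite !mxE; apply: (kP i ki (a, b)).
apply/matrixP => a b; apply/(limit_of_eq (ZU a b) (ZU' a b)) => n.
by have [k kP] := UU' n; exists k => i ki; have := kP i ki a b; rewrite !mxE.
Qed.

Lemma mx_limit_cauchy p q (Z : 'M[Rhat]_(p, q)) U : mx_limit Z U ->
  forall n, exists k, forall i j, (k <= i)%N -> (k <= j)%N -> mxin (m_exp n) (U i - U j).
Proof.
move=> ZU n; have [|k kP] := @uniform_bound _ (fun (ij : 'I_p * 'I_q) k =>
    forall i j, (k <= i)%N -> (k <= j)%N -> m_exp n (U i ij.1 ij.2 - U j ij.1 ij.2)).
  move=> [a b] /=; have [k kP] := limit_of_cauchy (ZU a b) n.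
  by exists k => l kl i j li lj; apply: kP; [apply: leq_trans li|apply: leq_trans lj].
by exists k => i j ki kj a b; rewrite !mxE; apply: (kP k (leqnn k) (a, b)).
Qed.

Hypothesis noethR : noetherian R.

(* If [u] is Cauchy and [u C] tends to 0, Artin-Rees for the rows of [C] gives *)
(* [e] tending to 0 with [u - e] in the row kernel of [C]; Artin-Rees for the  *)
(* rows of [V] then lifts the increments of [u - e] to small vectors.          *)
Lemma completion_flat a b c (C : 'M[R]_(b, a)) (V : 'M_(c, b)) :
  V *m C = 0 -> exact C V -> exact (map_mx iota C) (map_mx iota V).
Proof.
move=> VC exCV; apply: exact_of_rows => z zC.
have [u zu] := mx_limit_exists z.
have [kC kCP] := choice (artin_rees noethR idealrP C).
have [kV kVP] := choice (artin_rees noethR idealrP V).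
(* A row [r V] over [m^(g n)] has another lift over [m^n]; moreover [g n >= n], so errors over
   [m^(g n)] tend to 0. *)
have [g [g_kV g_le gS]] := monotone_majorant kV.
have uC0 N : exists k, forall i, (k <= i)%N -> mxin (m_exp N) (u i *m C).
  have z0 : mx_limit (0 : 'M[Rhat]_(1, a)) (fun=> 0).
    move=> i j; rewrite !mxE -(rmorph0 iota).
    exact: limit_of_cst.
  have [k kP] := (mx_limit_eq (mx_limitM C zu) z0).1 zC N.
  by exists k => i ki; have := kP i ki; rewrite subr0.
(* From [K n] on, [u C] is small enough to be corrected over [m^(g n)], and [u] varies only within
   [m^(g n)]. *)
have /choice[K KP] : forall n, exists k, forall i, (k <= i)%N ->
    mxin (m_exp (kC (g n))) (u i *m C) /\
    forall j, (k <= j)%N -> mxin (m_exp (g n)) (u i - u j).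
  move=> n; have [k1 k1P] := uC0 (kC (g n)).
  have [k2 k2P] := mx_limit_cauchy zu (g n).
  exists (k1 + k2)%N => i ki; split; first by apply/k1P/leq_trans/ki/leq_addr.
  move=> j kj; apply: k2P; first exact: leq_trans (leq_addl _ _) ki.
  exact: leq_trans (leq_addl _ _) kj.
have [phi [phi_K phi_le phiS]] := monotone_majorant K.
have /choice[e eP] : forall n, exists e,
    mxin (m_exp (g n)) e /\ e *m C = u (phi n) *m C.
  move=> n; have [uCn _] := KP n _ (phi_K n).
  by have [e me eC] := kCP _ _ uCn; exists e.
have /choice[b0 b0P] : forall n, exists r, u (phi n) - e n = r *m V.
  move=> n; have [_ eC] := eP n.
  by apply: exCV; rewrite mulmxBl eC subrr.
have /choice[r rP] : forall n, exists r,
    mxin (m_exp n) r /\ r *m V = (b0 n.+1 - b0 n) *m V.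
  move=> n; have idg := ideal_expP [set` m] (g n).
  have [|r mr rV] := kVP n (b0 n.+1 - b0 n); last by exists r.
  have sub i : mxin (m_exp (g n)) i -> mxin (m_exp (kV n)) i.
    by move=> mi x y; apply: (ideal_exp_le (g_kV n)).
  apply: sub; rewrite mulmxBl -!b0P opprB [e n - _]addrC addrACA [- e n.+1 + _]addrC.
  apply: (mxinD idg); last first.
    apply: (mxinB idg); first by have [] := eP n.
    by move=> x y; have [+ _] := eP n.+1; move=> /(_ x y); apply: (ideal_exp_le (gS n)).
  have [_] := KP n _ (leq_trans (phi_K n) (phiS n)); apply.
  exact: phi_K.
(* The [b0 n] are arbitrary lifts and need not be Cauchy; summing the small increments [r i] gives
   lifts of the same rows that are. *)
pose w n := b0 0%N + \sum_(i < n) r i.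
have wV n : w n *m V = u (phi n) - e n.
  rewrite b0P; elim: n => [|n IHn]; first by rewrite /w big_ord0 addr0.
  have -> : w n.+1 = w n + r n by rewrite /w big_ord_recr /= addrA.
  by rewrite mulmxDl IHn (rP n).2 mulmxBl addrC subrK.
have /choice[y yP] : forall j, exists y, @limit_of R m y (fun n => w n 0 j).
  move=> j; apply/cauchy_limit/cauchy_of_steps => n.
  rewrite (_ : w n.+1 0 j - w n 0 j = r n 0 j); first exact: (rP n).1.
  by rewrite /w big_ord_recr /= addrA !mxE addrAC subrr add0r.
have yw : mx_limit (\row_j y j) w by move=> i j; rewrite ord1 mxE.
exists (\row_j y j).
have zphi : mx_limit z (fun n => u (phi n)).
  by move=> i j; apply: (@limit_of_shift _ (fun n => u n i j)).
apply/(mx_limit_eq zphi (mx_limitM V yw)) => n; exists n => i ni.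
rewrite wV subKr => x y0; apply: (ideal_exp_le (leq_trans ni (g_le i))).
exact: (eP i).1.
Qed.

End CompletionFlat.

(** * The maximal ideal of the completion *)

Section CompletionLocal.
Variables (R : comNzRingType) (m : idealr R).
Local Notation Rhat := (completion m).
Local Notation iota := (@to_completion R m).
Hypothesis m_units : forall a, a \notin m -> exists b, b * a = 1.

(** The kernel of the residue map: a Cauchy sequence is eventually constant modulo [m]. *)
Definition completion_max : set Rhat :=
  [set z | exists u, limit_of z u /\ exists k, forall i, (k <= i)%N -> u i \in m].

Lemma completion_max_ideal : ideal completion_max.
Proof.
split=> [|a x y [u [xu [k ku]]] [v [yv [l lv]]]].
  exists (fun=> 0); split; first by rewrite -(rmorph0 iota); apply: limit_of_cst.
  by exists 0%N => i _; apply: idealr0.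
have [w aw] := limit_of_exists a.
exists (fun n => w n * u n + v n); split; first exact/limit_ofD/yv/limit_ofM.
exists (k + l)%N => i kli; apply: rpredD.
  by apply/idealMr/ku/leq_trans/kli/leq_addr.
by apply/lv/leq_trans/kli/leq_addl.
Qed.

Lemma completion_max_limit z u : completion_max z -> limit_of z u ->
  exists k, forall i, (k <= i)%N -> u i \in m.
Proof.
move=> [v [zv [k kv]]] zu.
have [l lP] := tends0_eventually ((limit_of_eq zu zv).1 erefl).
exists (k + l)%N => i kli; rewrite -[u i](subrK (v i)); apply: rpredD.
  by apply/lP/leq_trans/kli/leq_addl.
by apply/kv/leq_trans/kli/leq_addr.
Qed.

Lemma completion_max1 : ~ completion_max 1.
Proof.
rewrite -(rmorph1 iota) => /completion_max_limit/(_ (limit_of_cst _ _)).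
by move=> [k /(_ k (leqnn k))]; rewrite idealr1.
Qed.

Lemma to_completion_max a : a \in m -> completion_max (iota a).
Proof. by move=> ma; exists (fun=> a); split; [exact: limit_of_cst|exists 0%N]. Qed.

(** Eventually all terms are units, and their inverses form a Cauchy sequence because
    [1/u_i - 1/u_j = (u_j - u_i)/(u_i u_j)]. *)
Lemma completion_unit z : ~ completion_max z -> exists w, w * z = 1.
Proof.
move=> nmz; have [u zu] := limit_of_exists z; have cu := limit_of_cauchy zu.
have [k kP] := cu 1%N; rewrite (ideal_exp1 (idealrP m)) in kP.
have [i0 ki0 nmi0] : exists2 i0, (k <= i0)%N & u i0 \notin m.
  apply: contrapT => no; apply: nmz; exists u; split=> //; exists k => i ki.
  by apply: contrapT => /negP nmi; apply: no; exists i.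
have nmu i : (k <= i)%N -> u i \notin m.
  move=> ki; apply: contra nmi0 => mi; rewrite -[u i0](subrK (u i)).
  by apply: rpredD => //; apply: kP.
have /choice[v vP] : forall i, exists b, (k <= i)%N -> b * u i = 1.
  move=> i; have [ki|_] := leqP k i; last by exists 0.
  by have [b bu] := m_units (nmu i ki); exists b.
have [w wv] : exists w, @limit_of R m w v.
  apply: cauchy_limit => n; have [l lP] := cu n; exists (k + l)%N => i j ki kj.
  have idn := ideal_expP [set` m] n.
  have vi := vP i (leq_trans (leq_addr _ _) ki).
  have vj := vP j (leq_trans (leq_addr _ _) kj).
  have -> : v i - v j = v i * v j * (u j - u i).
    by rewrite mulrBr -mulrA vj mulr1 mulrAC vi mul1r.
  apply: (idealMl idn).
  by apply: lP; [exact: leq_trans (leq_addl _ _) kj|exact: leq_trans (leq_addl _ _) ki].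
exists w; rewrite -(rmorph1 iota).
apply/(limit_of_eq (limit_ofM wv zu) (limit_of_cst m 1)) => n; exists k => i ki.
by rewrite vP // subrr; apply: ideal0 (ideal_expP _ _).
Qed.

End CompletionLocal.

(** * The local ring [S/I] and its Burch pair *)

Section BurchQuotient.
Variables (S : comNzRingType) (n : set S) (I : idealr S).
Hypotheses (localS : local_ring n) (burchI : burch_ideal n [set` I]).
Local Notation A := ({ideal_quot I}).
Local Notation pi_I := (\pi_(A)%qT).

Definition quotient_max : set A := [set pi_I y | y in n].

Lemma local_ring_ideal : ideal n.
Proof. by case: localS => _ []. Qed.

Lemma local_ring_proper : ~ n 1.
Proof. by case: localS => _ []. Qed.

Lemma pi_ideal_eq0 y : pi_I y = 0 <-> y \in I.
Proof.
rewrite -(rmorph0 pi_I); split=> [/eqP|yI]; first by rewrite -Quotient.idealrBE subr0.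
by apply/eqP; rewrite -Quotient.idealrBE subr0.
Qed.

Lemma quotient_max_ideal : ideal quotient_max.
Proof.
split=> [|a _ _ [y ny <-] [z nz <-]]; last first.
  exists (repr a * y + z); first exact: local_ring_ideal.2.
  by rewrite rmorphD rmorphM /= reprK.
by exists 0; [exact: local_ring_ideal.1|rewrite rmorph0].
Qed.

Lemma idealr_sub_max y : y \in I -> n y.
Proof.
move=> yI; apply: contrapT => /(local_ring_unit localS)[b by1].
by have := idealr1 I; rewrite -by1 idealMr.
Qed.

Lemma quotient_max1 : ~ quotient_max 1.
Proof.
move=> [y ny y1]; apply: local_ring_proper; rewrite -[1](subrK y).
apply: (idealD local_ring_ideal) => //; apply: idealr_sub_max.
by apply/pi_ideal_eq0; rewrite rmorphB rmorph1 /= y1 subrr.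
Qed.

Lemma quotient_max_units a : ~ quotient_max a -> exists b, b * a = 1.
Proof.
move=> nma; have [|b by1] := local_ring_unit localS (a := repr a).
  by move=> na; apply: nma; exists (repr a) => //; rewrite reprK.
by exists (pi_I b); rewrite -[a]reprK -rmorphM by1 rmorph1.
Qed.

Lemma quotient_max_lift p q (X : 'M[A]_(p, q)) : mxin quotient_max X ->
  exists2 Y, mxin n Y & map_mx pi_I Y = X.
Proof.
move=> mX; have /choice[y yP] : forall ij, exists y, n y /\ pi_I y = X ij.1 ij.2.
  by move=> [i j]; have [y ny yX] := mX i j; exists y.
exists (\matrix_(i, j) y (i, j)) => [i j|]; first by rewrite mxE; case: (yP (i, j)).
by apply/matrixP => i j; rewrite !mxE (yP (i, j)).2.
Qed.

Lemma ideal_mul_mx p (a : 'rV[S]_p) (b : 'cV_p) :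
  mxin n a -> mxin [set` I] b -> ideal_mul n [set` I] ((a *m b) 0 0).
Proof.
move=> na Ib; rewrite mxE; apply: (ideal_sum (ideal_spanP _)) => k _.
by apply: sub_ideal_span; exists (a 0 k) => //; exists (b k 0).
Qed.

(** Since [n I] is always contained in [n (I : n)], the Burch inequality gives a product [y s]
    outside [n I]. If [a W = s e_j], then lifts to [S] satisfy [y s = a (W r) - (a W - s e_j) r],
    where [W r] and [a W - s e_j] are over [I] while [a] and [r] are over [n]: this puts [y s] in
    [n I]. *)
Lemma burch_pair_exists : exists s x, burch_pair quotient_max s x.
Proof.
have [idI nI] := burchI; pose nI' := ideal_mul n [set` I].
have idnI : ideal nI' by apply: ideal_spanP.
have [y [s [ny sP ysP]]] : exists y s,
    [/\ n y, ideal_colon [set` I] n s & ~ nI' (y * s)].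
  apply: contrapT => no; apply: nI; apply/seteqP; split; apply: ideal_span_sub.
  - exact: ideal_spanP.
  - move=> _ [y ny [s sI <-]]; apply: sub_ideal_span; exists y => //; exists s => //.
    by move=> b _; apply: (idealMrr idI).
  - exact: ideal_spanP.
  - move=> _ [y ny [s sI <-]]; apply: contrapT => ys.
    by apply: no; exists y, s.
exists (pi_I s), (pi_I y); split; first by exists y.
  move=> _ [b nb <-]; rewrite -rmorphM; apply/pi_ideal_eq0.
  by rewrite mulrC; apply: sP.
move=> p k r W a j mr ma Wr rj aW; apply: ysP.
have [r1 nr1 r1E] := quotient_max_lift mr; have [a1 na1 a1E] := quotient_max_lift ma.
(* The lift of [r] is adjusted at [j] to be [y] itself, so that [s e_j] pairs with it to [y s]. *)
pose r2 : 'cV_p := \col_i if i == j then y else r1 i 0.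
have nr2 : mxin n r2 by move=> i o; rewrite mxE; case: ifP.
have r2E : map_mx pi_I r2 = r.
  apply/matrixP => i o; rewrite ord1 !mxE -r1E; case: eqP => [->|_]; last by rewrite mxE.
  by rewrite -rj -r1E mxE.
pose W1 := map_mx repr W : 'M[S]_(k, p).
have W1E : map_mx pi_I W1 = W by apply/matrixP => i o; rewrite !mxE reprK.
have kerP u v (X : 'M[S]_(u, v)) : map_mx pi_I X = 0 -> mxin [set` I] X.
  by move=> /matrixP X0 i o; apply/pi_ideal_eq0; have := X0 i o; rewrite !mxE.
have IWr : mxin [set` I] (W1 *m r2) by apply: kerP; rewrite map_mxM W1E r2E.
have IaW : mxin [set` I] (a1 *m W1 - s *: delta_mx 0 j).
  by apply: kerP; rewrite map_mxB map_mxM map_mxZ map_delta_mx W1E a1E aW subrr.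
have -> : y * s = (a1 *m (W1 *m r2)) 0 0 - (r2^T *m (a1 *m W1 - s *: delta_mx 0 j)^T) 0 0.
  rewrite -trmx_mul mulmxBl linearB /= -scalemxAl -rowE mulmxA.
  by rewrite !mxE eqxx opprB addrC subrK mulrC.
apply: (idealB idnI); apply: ideal_mul_mx => //; exact: mxin_tr.
Qed.

End BurchQuotient.

(** * Induction along a regular sequence *)

Section RegularSequence.
Variables (B : comNzRingType) (xs : seq B).
Hypothesis xs_regular : forall i, (i < size xs)%N -> forall a,
  ideal_span [set` take i xs] (xs`_i * a) -> ideal_span [set` take i xs] a.
Local Notation I j := (ideal_span [set` take j xs]).

Lemma ideal_span_take j : (j < size xs)%N -> forall a,
  I j.+1 a <-> exists2 b, I j b & exists c, a = b + xs`_j * c.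
Proof. by move=> lt_j a; rewrite (take_nth 0) //; apply: ideal_span_rcons. Qed.

Lemma mxin_take0 p q (X : 'M[B]_(p, q)) : mxin (I 0) X <-> X = 0.
Proof.
rewrite take0; split=> [X0|-> i j]; last by rewrite mxE; apply/ideal_span_nil.
by apply/matrixP => i j; rewrite mxE; apply/ideal_span_nil.
Qed.

Variables (p q : nat -> nat).
Variables (D : forall i, 'M[B]_(p i.+1, p i)) (E : forall i, 'M[B]_(q i.+1, q i)).
Hypotheses (D2 : forall i, D i.+1 *m D i = 0) (E2 : forall i, E i.+1 *m E i = 0).

(** Each regular element costs one degree of exactness. *)
Lemma exact_mod_regular (exD : forall i, exact (D i) (D i.+1)) j :
  (j <= size xs)%N -> forall i, (j <= i)%N -> exact_mod (I j) (D i) (D i.+1).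
Proof.
elim: j => [_ i _ r X /mxin_take0/exD[Y ->]|j IHj lt_j [//|i] le_ji].
  by exists Y; apply/mxin_take0; rewrite subrr.
apply: (exact_mod_adjoin (ideal_spanP _) (ideal_span_take lt_j) (xs_regular lt_j) (D2 i)).
  by apply: IHj => //; apply: ltnW.
by apply: IHj; [apply: ltnW|apply: leqW].
Qed.

(** Each regular element merges two adjacent vanishings and loses the lowest. Taking [E] at index
    [size xs] makes its cokernel a high enough syzygy for all the elements to stay regular on it. *)
Lemma tor_vanishes_mod_regular lo hi :
  (forall j, (j <= size xs)%N -> forall i, (j <= i)%N ->
    exact_mod (I j) (E i) (E i.+1)) ->
  (forall i, (lo <= i <= hi)%N -> tor_vanishes (D i) (D i.+1) (E (size xs))) ->
  forall j, (j <= size xs)%N -> forall i, (lo + j <= i <= hi)%N ->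
    tor_vanishes_mod (I j) (D i) (D i.+1) (E (size xs)).
Proof.
move=> exEj tv; elim=> [_ i|j IHj lt_j].
  rewrite addn0 => /tv tvi X Y /mxin_take0/eqP; rewrite subr_eq0 => /eqP/tvi[U [V ->]].
  by exists U, V; apply/mxin_take0; rewrite subrr.
case=> [|i]; first by rewrite addnS.
rewrite addnS ltnS => /andP[le_i le_hi].
have tv0 := IHj (ltnW lt_j) i; have tv1 := IHj (ltnW lt_j) i.+1.
have ex := exEj j (ltnW lt_j) (size xs).-1.
case: (size xs) {IHj tv exEj} lt_j tv0 tv1 ex (ideal_span_take lt_j)
  (xs_regular lt_j) => //= s lt_j tv0 tv1 ex tk reg.
apply: (tor_vanishes_adjoin (ideal_spanP _) tk reg (D2 i) (E2 s)).
- exact: ex.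
- by apply: tv0; rewrite le_i ltnW.
- by apply: tv1; rewrite le_hi leqW.
Qed.

End RegularSequence.

(** * Iterated shifting, uniqueness of the depth, and the reduction to rigidity *)

Lemma tor_vanishes_shiftn (R : comNzRingType) (m : set R) (M N : lmodType R)
    (F : min_resolution m M) (G : min_resolution m N) s i :
  tor_vanishes (mr_diff F (i + s)) (mr_diff F (i + s).+1) (mr_diff G 0) ->
  tor_vanishes (mr_diff F i) (mr_diff F i.+1) (mr_diff G s).
Proof.
elim: s i => [|s IHs] i; first by rewrite addn0.
rewrite addnS -addSn => /IHs; apply: tor_vanishes_shift; first exact: mr_diff2.
- exact: mr_diff2.
- exact: mr_exact.
- exact: mr_exact.
Qed.

Lemma has_depth_unique (R : comNzRingType) (m : set R) t t' :
  has_depth m t -> has_depth m t' -> t = t'.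
Proof.
move=> [[x [xreg xm]] tmax] [[x' [xreg' xm']] tmax'].
apply/eqP; rewrite eqn_leq -{1}(size_tuple x) -{2}(size_tuple x').
by rewrite tmax' ?tmax.
Qed.

Theorem theorem1p4 (R : comNzRingType) (m : idealr R) (t : nat)
    (Rlocal : local_ring [set` m]) (Rdepth : has_depth [set` m] t)
    (Rburch : burch_ring m) (M N : lmodType R)
    (Mfg : fin_gen M) (Nfg : fin_gen N) (l : nat)
    (hl : (maxn 3 t.+1 <= l)%N)
    (hTor : forall i, (l + t <= i <= l + 2 * t + 1)%N -> Tor_eq0 M N i) :
  finite_proj_dim M \/ finite_proj_dim N.
Proof.
have noethR : noetherian R by case: Rlocal.
have m_units := local_ring_unit Rlocal.
have idm : ideal [set` m] := idealrP m.
have m1 : ~ [set` m] 1 by rewrite /= idealr1.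
have [F] := min_resolution_exists noethR m_units Mfg.
have [G] := min_resolution_exists noethR m_units Nfg.
have [t' depth' [x [J [xreg JE [S [n [I [[localS _] burchI [f f_bij]]]]]]]]] := Rburch.
have tt' := has_depth_unique Rdepth depth'; subst t'.
have size_x : size x = t := size_tuple x.
pose iota := @to_completion R m : {rmorphism R -> completion m}.
pose g : {rmorphism completion m -> {ideal_quot I}} := f \o \pi_({ideal_quot J})%qT.
have [f' fK f'K] := f_bij.
have g_surj a : exists z, g z = a by exists (repr (f' a)); rewrite /= reprK f'K.
have g_ker z : g z = 0 <-> ideal_span [set` x] z.
  rewrite -JE /= -(pi_ideal_eq0 J z) -(rmorph0 f).
  by split=> [/(can_inj fK)|->].
have mhat_unit (z : completion m) : ~ completion_max z -> exists w, w * z = 1.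
  by apply: completion_unit => a /negP; apply: m_units.
have x_max (z : completion m) : ideal_span [set` x] z -> completion_max z.
  apply: ideal_span_sub; first exact: completion_max_ideal.
  move=> y xy; apply: contrapT => /mhat_unit[w wy].
  apply: xreg.1.1; rewrite -wy; apply: (idealMl (ideal_spanP [set` x])).
  exact: sub_ideal_span.
have idA := quotient_max_ideal I localS.
(* The map from [R] to [A] is local: if [z] lifts an inverse of the image of [a], then [z a - 1]
   lies in the ideal of the sequence, hence in the maximal ideal; as [a] does too, 1 would. *)
have g_local a : a \in m -> @quotient_max S n I (g (iota a)).
  move=> ma; apply: contrapT => /(quotient_max_units localS)[b].
  have [z <-] := g_surj b; rewrite -rmorphM -(rmorph1 g) => /eqP.
  rewrite -subr_eq0 -rmorphB => /eqP/g_ker/x_max mz.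
  apply: (@completion_max1 R m); rewrite -(subKr (z * iota a) 1).
  apply: idealB mz; first exact: completion_max_ideal.
  apply: idealMl; [exact: completion_max_ideal|exact: to_completion_max].
have flat := @completion_flat R m noethR.
pose DH i := map_mx iota (mr_diff F i); pose EH i := map_mx iota (mr_diff G i).
have DH2 i : DH i.+1 *m DH i = 0 by rewrite /DH -map_mxM mr_diff2 map_mx0.
have EH2 i : EH i.+1 *m EH i = 0 by rewrite /EH -map_mxM mr_diff2 map_mx0.
have exDH i : exact (DH i) (DH i.+1) by apply: flat; [exact: mr_diff2|exact: mr_exact].
have exEH i : exact (EH i) (EH i.+1) by apply: flat; [exact: mr_diff2|exact: mr_exact].
have l3 : (3 <= l)%N by apply: leq_trans hl; apply: leq_maxl.
(* Index [i] concerns homological degree [i + 1]; the shift by [t] turns it into Tor of index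
   [i + t + 1], which runs exactly over the given range. *)
have torH i : (l.-1 <= i <= l + t)%N -> tor_vanishes (DH i) (DH i.+1) (EH (size x)).
  move=> /andP[le_i i_le]; rewrite size_x; apply: (tor_vanishes_flat noethR flat).
  apply: tor_vanishes_shiftn; apply: Tor_eq0_tor_vanishes; apply: hTor; lia.
have xr := xreg.1.2.
have exDJ := exact_mod_regular xr DH2 exDH (leqnn (size x)).
have exEJ := exact_mod_regular xr EH2 exEH.
(* Of these indices only [l + t - 1] and [l + t] survive division by the [t] elements. *)
have torJ := tor_vanishes_mod_regular xr DH2 EH2 exEJ torH (leqnn (size x)).
rewrite take_size size_x in exDJ torJ.
have {exEJ}exEJ := exEJ _ (leqnn (size x)); rewrite take_size size_x in exEJ.
(* Thus [c + 2] and [c + 3] are the two surviving indices, and [c >= t] is in the range where the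
   complex of [M] is still exact. *)
pose c := (l - 3 + t)%N.
have mxin_g p q (X : 'M[R]_(p, q)) : mxin [set` m] X ->
    mxin (@quotient_max S n I) (map_mx g (map_mx iota X)).
  by move=> mX i j; rewrite !mxE; apply: g_local; apply: mX.
have g2 p q r (X : 'M_(p, q)) (Y : 'M_(q, r)) : X *m Y = 0 ->
    map_mx g X *m map_mx g Y = 0.
  by move=> XY; rewrite -map_mxM XY map_mx0.
have exA p q r (X : 'M_(p, q)) (Y : 'M_(r, p)) :=
  @exact_quotient _ _ _ _ g_surj g_ker q p r X Y.
have torA p0 p1 p2 q0 q1 X Y Z :=
  @tor_vanishes_quotient _ _ _ _ g_surj g_ker p0 p1 p2 q0 q1 X Y Z.
have [s [y sy]] := burch_pair_exists burchI.
have [] := @burch_rigidity _ _ s y idA (quotient_max1 localS)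
  (quotient_max_units localS) sy
  _ _ _ _ _ _ _ _ _ (map_mx g (DH c)) (map_mx g (DH c.+1)) (map_mx g (DH c.+2))
  (map_mx g (DH c.+3)) (map_mx g (DH c.+4)) (map_mx g (EH t)) (map_mx g (EH t.+1)).
- by apply: mxin_g; apply: mr_min.
- by apply: mxin_g; apply: mr_min.
- by apply: mxin_g; apply: mr_min.
- by apply: mxin_g; apply: mr_min.
- by apply: mxin_g; apply: mr_min.
- by apply: mxin_g; apply: mr_min.
- exact: g2.
- exact: g2.
- exact: g2.
- by apply: exA; apply: exDJ; rewrite /c; lia.
- by apply: exA; apply: exDJ; rewrite /c; lia.
- by apply: exA; apply: exDJ; rewrite /c; lia.
- by apply: exA; apply: exEJ.
- by apply: torA; apply: torJ; rewrite /c; lia.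
- by apply: torA; apply: torJ; rewrite /c; lia.
- by left; apply: (finite_proj_dim_of_rank (F := F) idm m1 (i := c.+1)).
- by right; apply: (finite_proj_dim_of_rank (F := G) idm m1 (i := t.+1)).
Qed.
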